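(* Let $(\mathcal{K},\leq_{\mathcal{K}})$ be a metric abstract elementary class, regarded as a category whose morphisms are the $\mathcal{K}$-embeddings. Then $\mathcal{K}$ has all directed colimits and is $\lambda$-accessible for every uncountable regular cardinal $\lambda>LS^d(\mathcal{K})$. Moreover, for any uncountable cardinal $\lambda$, an object $M\in\mathcal{K}$ has presentability rank $\lambda^+$ if and only if $\mathrm{dc}(M)=\lambda$.
   Context: Let $L$ be a many-sorted language with a set $\mathcal{S}$ of sorts together with a sort for the reals, function symbols including a distinguished symbol $d_\sigma$ for each $\sigma\in\mathcal{S}$, relation symbols, and constant symbols. A metric $L$-structure $M$ interprets each sort $\sigma\in\mathcal{S}$ as a complete metric space $(\sigma^M,d_\sigma^M)$, the real sort as $\mathbb{R}$, each constant as an element of its sort, each function symbol as a continuous map from the appropriate product of sorts (with the maximum metric) to the appropriate sort, and each relation symbol $R$ as a continuous map $R^M$ from the appropriate product of sorts to $[0,1]$. An embedding $f:M\to N$ of metric $L$-structures is a sortwise map preserving constants and commuting with all function symbols (so it is an isometry on each sort) and satisfying $d(\bar a,(R^M)^{-1}(k))=d(f(\bar a),(R^N)^{-1}(k))$ for all relation symbols $R$, tuples $\bar a$ and $k\in[0,1]$; $M$ is a substructure of $N$ if the inclusion is an embedding. The density character $\mathrm{dc}(X)$ of a complete metric space is the least cardinality of a dense subset; for a subset $A$, $\mathrm{dc}(A)$ is the density character of its closure; for a structure, $\mathrm{dc}(M)$ is the sum of the density characters of its sorts. A metric abstract elementary class (mAEC) is a class $\mathcal{K}$ of metric $L$-structures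 with a partial order $\leq_{\mathcal{K}}$ refining the substructure relation such that: (1) $\mathcal{K}$ and $\leq_{\mathcal{K}}$ are closed under isomorphism; (2) for every $\leq_{\mathcal{K}}$-increasing chain $(M_i)_{i<\lambda}$, the functions and relations extend uniquely to the completion $\overline{\bigcup_i M_i}$ so that it lies in $\mathcal{K}$, $M_i\leq_{\mathcal{K}}\overline{\bigcup_i M_i}$ for all $i$, and if $M_i\leq_{\mathcal{K}}N$ for all $i$ then $\overline{\bigcup_i M_i}\leq_{\mathcal{K}}N$; (3) (coherence) if $M_1$ is a substructure of $M_2$, $M_2\leq_{\mathcal{K}}M_3$ and $M_1\leq_{\mathcal{K}}M_3$, then $M_1\leq_{\mathcal{K}}M_2$; (4) (Löwenheim–Skolem) there is an infinite cardinal $LS^d(\mathcal{K})$ such that for all $M\in\mathcal{K}$ and $A\subseteq M$ there is $N\in\mathcal{K}$ with $A\subseteq N\leq_{\mathcal{K}}M$ and $\mathrm{dc}(N)\leq\mathrm{dc}(A)+LS^d(\mathcal{K})$. A $\mathcal{K}$-embedding is an embedding $f:M\to N$ with $M,N\in\mathcal{K}$ and $f[M]\leq_{\mathcal{K}}N$. Category-theoretic notions: for a regular cardinal $\lambda$, a $\lambda$-directed colimit is a colimit of a diagram indexed by a $\lambda$-directed poset; an object $M$ is $\lambda$-presentable if the hom-functor $\mathrm{Hom}(M,-)$ preserves $\lambda$-directed colimits; a category is $\lambda$-accessible if it has $\lambda$-directed colimits and has a set of $\lambda$-presentable objects such that every object is a $\lambda$-directed colimit of objects from that set. The presentability rank of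 an object is the least regular cardinal $\kappa$ such that it is $\kappa$-presentable.
   Formalization: In the ''moreover'' clause, the equivalence between presentability rank λ^+ and dc(M)=λ is stated only for uncountable λ > LS^d(K), since for uncountable λ ≤ LS^d(K) it is false in general. *)

(* Defs.v *)
From HB Require Import structures.
From mathcomp Require Import all_boot all_order all_algebra.
From mathcomp Require Import all_classical all_reals.
From mathcomp Require Import wochoice ereal topology.

Set Implicit Arguments.
Unset Strict Implicit.
Unset Printing Implicit Defensive.

Import Order.TTheory GRing.Theory Num.Theory.

Local Open Scope classical_set_scope.
Local Open Scope card_scope.
Local Open Scope ring_scope.

(* "Sets", as opposed to proper classes, are the types of the universe in which
   the points of a [metricType] live.  Symbols of a language, index posets and
   cardinals are in it; structures, hence objects of the category of a metric
   AEC, form a larger type.  A cardinal is a small type, taken up to [#=]. *)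
Notation small := Type@{Metric.axioms_.u0}.

Definition card_lt (T U : Type) (A : set T) (B : set U) : Prop :=
  A #<= B /\ ~ (B #<= A).
Notation "A '#<' B" := (card_lt A B) (at level 70, no associativity) : card_scope.

Definition infinite (k : small) : Prop := [set: nat] #<= [set: k].

Definition uncountable (k : small) : Prop := ~ countable [set: k].

Definition regular (k : small) : Prop :=
  infinite k /\
  forall (I : small) (F : I -> small),
    ([set: I] #< [set: k]) -> (forall i, [set: F i] #< [set: k]) ->
    ([set: {i : I & F i}] #< [set: k]).

(* [is_successor l k] : k = l^+ *)
Definition is_successor (l k : small) : Prop :=
  ([set: l] #< [set: k]) /\
  forall m : small, ([set: l] #< [set: m]) -> [set: k] #<= [set: m].

Record category := Category {
  obj :> Type;
  hom : obj -> obj -> small;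
  idm : forall X, hom X X;
  comp : forall X Y Z, hom Y Z -> hom X Y -> hom X Z;
  compA : forall X Y Z W (h : hom Z W) (g : hom Y Z) (f : hom X Y),
    comp h (comp g f) = comp (comp h g) f;
  comp1m : forall X Y (f : hom X Y), comp (idm Y) f = f;
  compm1 : forall X Y (f : hom X Y), comp f (idm X) = f
}.
Arguments idm {c} X.
Arguments comp {c X Y Z}.

Definition SET : category := @Category small (fun A B => A -> B)
  (fun A x => x) (fun A B C g f x => g (f x))
  (fun _ _ _ _ _ _ _ => erefl) (fun _ _ _ => erefl) (fun _ _ _ => erefl).

Record diagram (C : category) (I : small) (le : rel I) := Diagram {
  dobj :> I -> C;
  dmap : forall i j, le i j -> hom (dobj i) (dobj j);
  dmap1 : forall i (h : le i i), dmap h = idm (dobj i);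
  dmapM : forall i j k (hij : le i j) (hjk : le j k) (hik : le i k),
    comp (dmap hjk) (dmap hij) = dmap hik
}.
Arguments dmap {C I le} d {i j}.

Record cocone (C : category) (I : small) (le : rel I) (D : diagram C le) (X : C) :=
  Cocone {
  leg :> forall i, hom (D i) X;
  legM : forall i j (h : le i j), comp (leg j) (dmap D h) = leg i
}.
Arguments leg {C I le D X} c i.

Definition is_colimit (C : category) (I : small) (le : rel I)
    (D : diagram C le) (X : C) (c : cocone D X) : Prop :=
  forall (Y : C) (c' : cocone D Y),
    exists! f : hom X Y, forall i, comp f (leg c i) = leg c' i.

(* Every subset of cardinality < k has an upper bound; directed means
   aleph_0-directed, and implies nonempty. *)
Definition card_directed (k : small) (I : small) (le : rel I) : Prop :=
  partial_order le /\
  forall A : set I, (A #< [set: k]) -> exists j, forall i, A i -> le i j.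

Definition has_card_directed_colimits (k : small) (C : category) : Prop :=
  forall (I : small) (le : rel I), card_directed k le ->
  forall D : diagram C le, exists (X : C) (c : cocone D X), is_colimit c.

Section HomFunctor.
Variables (C : category) (M : C) (I : small) (le : rel I) (D : diagram C le).

Let hom_dobj (i : I) : SET := hom M (D i).
Let hom_dmap i j (h : le i j) : hom (hom_dobj i) (hom_dobj j) :=
  fun f => comp (dmap D h) f.

Let hom_dmap1 i (h : le i i) : hom_dmap h = idm (hom_dobj i).
Proof. by apply/funext => f; rewrite /hom_dmap dmap1 comp1m. Qed.

Let hom_dmapM i j k (hij : le i j) (hjk : le j k) (hik : le i k) :
  comp (hom_dmap hjk) (hom_dmap hij) = hom_dmap hik.
Proof.
by apply/funext => f; rewrite /hom_dmap /= compA (dmapM D hij hjk hik).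
Qed.

Definition hom_diagram : diagram SET le := Diagram hom_dmap1 hom_dmapM.

Variables (X : C) (c : cocone D X).

Let hom_leg i : hom (hom_diagram i) (hom M X : SET) := fun f => comp (leg c i) f.

Let hom_legM i j (h : le i j) : comp (@hom_leg j) (dmap hom_diagram h) = @hom_leg i.
Proof. by apply/funext => f; rewrite /hom_leg /= /hom_dmap compA legM. Qed.

Definition hom_cocone : cocone hom_diagram (hom M X : SET) := Cocone hom_legM.

End HomFunctor.

(* Hom(M, -) : C -> SET preserves k-directed colimits. *)
Definition presentable (k : small) (C : category) (M : C) : Prop :=
  forall (I : small) (le : rel I), card_directed k le ->
  forall (D : diagram C le) (X : C) (c : cocone D X),
    is_colimit c -> is_colimit (hom_cocone M c).

Definition accessible (k : small) (C : category) : Prop :=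
  has_card_directed_colimits k C /\
  exists (A : small) (G : A -> C),
    (forall a, presentable k (G a)) /\
    forall X : C, exists (I : small) (le : rel I) (D : diagram C le) (c : cocone D X),
      [/\ card_directed k le, is_colimit c & forall i, exists a, D i = G a].

Definition presentability_rank (C : category) (M : C) (k : small) : Prop :=
  [/\ regular k, presentable k M &
      forall m : small, regular m -> presentable m M -> [set: k] #<= [set: m]].

(* The library's [completeType] is pointed, whereas a sort may be empty. *)
Definition is_complete (R : realType) (X : metricType R) : Prop :=
  forall F : set_system X, ProperFilter F -> cauchy F -> exists l : X, F --> l.

(* A sort is [Some s] with s in [Lsort L], or [None], the sort of the reals.
   The symbols d_s are not listed in [Lfun]: they are present in every language
   and interpreted by the metric of the sort. *)
Record language := Language {
  Lsort : small;
  Lconst : small;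
  const_sort : Lconst -> option Lsort;
  Lfun : small;
  fun_arity : Lfun -> nat;
  fun_dom : forall f, 'I_(fun_arity f) -> option Lsort;
  fun_cod : Lfun -> option Lsort;
  Lrel : small;
  rel_arity : Lrel -> nat;
  rel_dom : forall r, 'I_(rel_arity r) -> option Lsort
}.
Arguments fun_dom {l} f.
Arguments rel_dom {l} r.

Definition sort_interp (R : realType) (S : Type) (M : S -> metricType R)
    (s : option S) : metricType R :=
  if s is Some s' then M s' else R^o.

Section Product.
Variables (R : realType) (n : nat) (X : 'I_n -> metricType R).

Definition max_dist (a b : forall i, X i) : R :=
  \big[Num.max/0]_(i < n) mdist (a i) (b i).

Definition max_continuous (Y : metricType R) (f : (forall i, X i) -> Y) : Prop :=
  forall a (e : R), 0 < e ->
    exists2 d : R, 0 < d & forall b, max_dist a b < d -> mdist (f a) (f b) < e.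

(* The distance to the empty set is +oo. *)
Definition dist_to (a : forall i, X i) (A : set (forall i, X i)) : \bar R :=
  ereal_inf [set (max_dist a b)%:E | b in A].

End Product.

Record structure (R : realType) (L : language) := Structure {
  str_sort : Lsort L -> metricType R;
  str_complete : forall s, is_complete (str_sort s);
  str_const : forall c : Lconst L, sort_interp str_sort (const_sort c);
  str_fun : forall f : Lfun L,
    (forall i, sort_interp str_sort (fun_dom f i)) -> sort_interp str_sort (fun_cod f);
  str_fun_continuous : forall f, max_continuous (@str_fun f);
  str_rel : forall r : Lrel L, (forall i, sort_interp str_sort (rel_dom r i)) -> R^o;
  str_rel01 : forall r a, 0 <= @str_rel r a <= 1;
  str_rel_continuous : forall r, max_continuous (@str_rel r)
}.

Definition car (R : realType) (L : language) (M : structure R L) :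
  option (Lsort L) -> metricType R := sort_interp (str_sort M).

(* A sortwise map, extended by the identity on the real sort. *)
Definition map_interp (R : realType) (L : language) (M N : structure R L)
    (f : forall s, str_sort M s -> str_sort N s) (s : option (Lsort L)) :
    car M s -> car N s :=
  match s with Some s' => f s' | None => id end.

Record embedding (R : realType) (L : language) (M N : structure R L) := Embedding {
  emb_fun : forall s, str_sort M s -> str_sort N s;
  emb_const : forall c, map_interp emb_fun (str_const M c) = str_const N c;
  emb_dist : forall s (x y : str_sort M s),
    mdist (emb_fun x) (emb_fun y) = mdist x y;
  emb_funP : forall f (a : forall i, car M (fun_dom f i)),
    map_interp emb_fun (str_fun a) =
    str_fun (fun i => map_interp emb_fun (a i) : car N (fun_dom f i));
  emb_rel : forall r (a : forall i, car M (rel_dom r i)) (k : R), 0 <= k <= 1 ->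
    dist_to a (@str_rel _ _ M r @^-1` [set k]) =
    dist_to (fun i => map_interp emb_fun (a i) : car N (rel_dom r i))
      (@str_rel _ _ N r @^-1` [set k])
}.

Definition emb_app (R : realType) (L : language) (M N : structure R L)
  (f : embedding M N) (s : option (Lsort L)) : car M s -> car N s :=
  @map_interp _ _ M N (emb_fun f) s.
Coercion emb_app : embedding >-> Funclass.
Arguments emb_app {R L M N} f {s}.

Section Embeddings.
Variables (R : realType) (L : language).

Lemma emb_eq (M N : structure R L) (f g : embedding M N) :
  (forall s (x : car M s), f s x = g s x) -> f = g.
Proof.
case: f g => [f f1 f2 f3 f4] [g g1 g2 g3 g4] /= fg.
have {}fg : f = g.
  by apply: functional_extensionality_dep => s; apply/funext => x; exact: (fg (Some s)).
subst g.
by rewrite (Prop_irrelevance f1 g1) (Prop_irrelevance f2 g2)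
  (Prop_irrelevance f3 g3) (Prop_irrelevance f4 g4).
Qed.

Let map_id (M : structure R L) s (x : car M s) : @map_interp _ _ M M (fun=> id) s x = x.
Proof. by case: s x. Qed.

Let map_idt (M : structure R L) n (d : 'I_n -> option (Lsort L))
    (a : forall i, car M (d i)) : (fun i => @map_interp _ _ M M (fun=> id) (d i) (a i)) = a.
Proof. by apply: functional_extensionality_dep => i; exact: map_id. Qed.

Fact id_emb_const (M : structure R L) c :
  @map_interp _ _ M M (fun=> id) _ (str_const M c) = str_const M c.
Proof. exact: map_id. Qed.

Fact id_emb_fun (M : structure R L) f (a : forall i, car M (fun_dom f i)) :
  @map_interp _ _ M M (fun=> id) _ (str_fun a) =
  str_fun (fun i => @map_interp _ _ M M (fun=> id) _ (a i) : car M (fun_dom f i)).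
Proof. by rewrite map_idt; exact: map_id. Qed.

Fact id_emb_rel (M : structure R L) r (a : forall i, car M (rel_dom r i)) (k : R) :
  0 <= k <= 1 ->
  dist_to a (@str_rel _ _ M r @^-1` [set k]) =
  dist_to (fun i => @map_interp _ _ M M (fun=> id) _ (a i) : car M (rel_dom r i))
    (@str_rel _ _ M r @^-1` [set k]).
Proof. by rewrite map_idt. Qed.

Definition id_emb (M : structure R L) : embedding M M :=
  @Embedding _ _ M M (fun=> id) (@id_emb_const M) (fun _ _ _ => erefl)
    (@id_emb_fun M) (@id_emb_rel M).

Section Composition.
Variables (M N P : structure R L) (g : embedding N P) (f : embedding M N).

Let h s (x : str_sort M s) := emb_fun g (emb_fun f x).

Let map_comp s (x : car M s) :
  @map_interp _ _ M P h s x = map_interp (emb_fun g) (map_interp (emb_fun f) x).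
Proof. by case: s x. Qed.

Let map_compt n (d : 'I_n -> option (Lsort L)) (a : forall i, car M (d i)) :
  (fun i => @map_interp _ _ M P h (d i) (a i)) =
  (fun i => map_interp (emb_fun g) (map_interp (emb_fun f) (a i))).
Proof. by apply: functional_extensionality_dep => i; exact: map_comp. Qed.

Fact comp_emb_const c : @map_interp _ _ M P h _ (str_const M c) = str_const P c.
Proof. by rewrite map_comp !emb_const. Qed.

Fact comp_emb_dist s (x y : str_sort M s) : mdist (h x) (h y) = mdist x y.
Proof. by rewrite /h !emb_dist. Qed.

Fact comp_emb_fun u (a : forall i, car M (fun_dom u i)) :
  @map_interp _ _ M P h _ (str_fun a) =
  str_fun (fun i => @map_interp _ _ M P h _ (a i) : car P (fun_dom u i)).
Proof. by rewrite map_comp map_compt !emb_funP. Qed.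

Fact comp_emb_rel r (a : forall i, car M (rel_dom r i)) (k : R) : 0 <= k <= 1 ->
  dist_to a (@str_rel _ _ M r @^-1` [set k]) =
  dist_to (fun i => @map_interp _ _ M P h _ (a i) : car P (rel_dom r i))
    (@str_rel _ _ P r @^-1` [set k]).
Proof.
by move=> k01; rewrite map_compt (emb_rel f _ k01) (emb_rel g _ k01).
Qed.

Definition comp_emb : embedding M P :=
  Embedding comp_emb_const comp_emb_dist comp_emb_fun comp_emb_rel.

End Composition.

Lemma id_embE (M : structure R L) s (x : car M s) : id_emb M s x = x.
Proof. exact: map_id. Qed.

Lemma comp_embE (M N P : structure R L) (g : embedding N P) (f : embedding M N)
  s (x : car M s) : comp_emb g f s x = g s (f s x).
Proof. by case: s x. Qed.

Definition is_iso (M N : structure R L) (f : embedding M N) : Prop :=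
  forall s, bijective (f s).

End Embeddings.

(* [k] is the least cardinality of a dense subset of the subspace [A]. *)
Definition density_character (R : realType) (X : metricType R) (A : set X)
    (k : small) : Prop :=
  (exists D : set X, [/\ D `<=` A, A `<=` closure D & D #= [set: k]]) /\
  (forall D : set X, D `<=` A -> A `<=` closure D -> [set: k] #<= D).

Definition sum_density (R : realType) (L : language) (M : structure R L)
    (A : forall s, set (car M s)) (k : small) : Prop :=
  exists2 d : option (Lsort L) -> small,
    forall s, density_character (A s) (d s) & [set: k] #= [set: {s & d s}].

Definition dc_is (R : realType) (L : language) (M : structure R L) (k : small) : Prop :=
  sum_density (fun s => [set: car M s]) k.

Definition dc_subset_is (R : realType) (L : language) (M : structure R L)
    (A : forall s, set (car M s)) (k : small) : Prop :=
  sum_density (fun s => closure (A s)) k.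

(* Carriers are types, so inclusions are replaced by the embeddings that play
   their role: for an embedding f : M -> N, [leK f] means f[M] <=_K N.  It is a
   property of f[M] because of [leK_iso].  Antisymmetry of <=_K has no
   counterpart: it only says that a structure included in one of its own
   substructures is equal to it. *)
Record mAEC (R : realType) (L : language) := MAEC {
  inK : structure R L -> Prop;
  leK : forall M N : structure R L, embedding M N -> Prop;
  leK_inK : forall M N (f : embedding M N), leK f -> inK M /\ inK N;
  leK_refl : forall M, inK M -> leK (id_emb M);
  leK_trans : forall M N P (f : embedding M N) (g : embedding N P),
    leK f -> leK g -> leK (comp_emb g f);
  inK_iso : forall M N (f : embedding M N), is_iso f -> inK M -> inK N;
  leK_iso : forall M N M' N' (f : embedding M N) (f' : embedding M' N')
      (a : embedding M M') (b : embedding N N'),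
    is_iso a -> is_iso b -> comp_emb b f = comp_emb f' a -> leK f -> leK f';
  (* A structure U into which the M_i embed compatibly, with dense union of
     images, is the completion of the union of the chain; the functions and
     relations of such a U are determined by those of the M_i, by continuity. *)
  leK_chain : forall (I : small) (le : rel I) (M : I -> structure R L)
      (m : forall i j, le i j -> embedding (M i) (M j)),
    inhabited I -> well_order le ->
    (forall i (h : le i i), m i i h = id_emb (M i)) ->
    (forall i j k (hij : le i j) (hjk : le j k) (hik : le i k),
       comp_emb (m j k hjk) (m i j hij) = m i k hik) ->
    (forall i j (h : le i j), leK (m i j h)) ->
    exists (U : structure R L) (u : forall i, embedding (M i) U),
      [/\ (forall i j (h : le i j), comp_emb (u j) (m i j h) = u i),
          (forall s, dense (\bigcup_i range (u i s))),
          inK U, (forall i, leK (u i)) &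
          forall (N : structure R L) (f : forall i, embedding (M i) N),
            (forall i j (h : le i j), comp_emb (f j) (m i j h) = f i) ->
            (forall i, leK (f i)) ->
            exists2 g : embedding U N, forall i, comp_emb g (u i) = f i & leK g];
  leK_coherence : forall M1 M2 M3 (f : embedding M1 M2) (g : embedding M2 M3),
    leK g -> leK (comp_emb g f) -> leK f;
  (* An infinite cardinal that witnesses the Loewenheim-Skolem axiom, not
     required to be the least one. *)
  LS : small;
  LS_infinite : infinite LS;
  leK_LS : forall (M : structure R L) (A : forall s, set (car M s)), inK M ->
    exists (N : structure R L) (f : embedding N M),
      [/\ leK f, (forall s, A s `<=` range (f s)) &
          exists (n a : small), [/\ dc_is N n, dc_subset_is A a &
            [set: n] #<= [set: (a + LS)%type]]]
}.

Section CategoryOfMAEC.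
Variables (R : realType) (L : language) (K : mAEC R L).

Definition mAEC_obj := {M : structure R L | inK K M}.

Definition mAEC_hom (M N : mAEC_obj) : small :=
  {f : embedding (sval M) (sval N) | leK K f}.

Let hom_eq (M N : mAEC_obj) (f g : mAEC_hom M N) :
  (forall s (x : car (sval M) s), sval f s x = sval g s x) -> f = g.
Proof.
case: f g => [f hf] [g hg] /= /emb_eq fg; subst g.
by rewrite (Prop_irrelevance hf hg).
Qed.

Definition mAEC_id (M : mAEC_obj) : mAEC_hom M M :=
  exist _ (id_emb (sval M)) (leK_refl (svalP M)).

Definition mAEC_comp (M N P : mAEC_obj) (g : mAEC_hom N P) (f : mAEC_hom M N) :
    mAEC_hom M P :=
  exist _ (comp_emb (sval g) (sval f)) (leK_trans (svalP f) (svalP g)).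

Let mAEC_compA M N P Q (h : mAEC_hom P Q) (g : mAEC_hom N P) (f : mAEC_hom M N) :
  mAEC_comp h (mAEC_comp g f) = mAEC_comp (mAEC_comp h g) f.
Proof. by apply: hom_eq => s x; rewrite !comp_embE. Qed.

Let mAEC_comp1m M N (f : mAEC_hom M N) : mAEC_comp (mAEC_id N) f = f.
Proof. by apply: hom_eq => s x; rewrite comp_embE id_embE. Qed.

Let mAEC_compm1 M N (f : mAEC_hom M N) : mAEC_comp f (mAEC_id M) = f.
Proof. by apply: hom_eq => s x; rewrite comp_embE id_embE. Qed.

Definition mAEC_category : category :=
  Category mAEC_compA mAEC_comp1m mAEC_compm1.

End CategoryOfMAEC.

(* Main.v *)
(* A directed colimit of structures is the completion of their directed union.
   The chain axiom only gives it for well-ordered systems; a general directed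
   system is reduced to these by induction on its cardinality, with Iwamura's
   lemma.  A cocone of K-embeddings is a colimit exactly when the union of the
   ranges of its legs is dense, since an isometry with dense range between
   complete spaces is onto.

   Let lam be uncountable.  In a lam-directed colimit countably many legs are
   bounded by one leg, whose range is closed, so the legs are jointly onto; hence
   a K-embedding of a structure with a dense set of less than lam points factors
   through a leg, by coherence, and such structures are lam-presentable.  When
   lam > LS is regular, any less than lam points of X lie in a substructure of
   this kind, so X is the lam-directed colimit of these substructures.  In
   particular, a lam-presentable X is isomorphic to one of them.  So for such lam
   the lam-presentable objects are those with dc < lam, and the presentability
   rank is read off by applying this to successor cardinals. *)
From mathcomp Require Import all_boot all_order all_algebra.
From mathcomp Require Import all_classical all_reals.
From mathcomp Require Import wochoice ereal topology.
Require Import Defs.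

Set Implicit Arguments.
Unset Strict Implicit.
Unset Printing Implicit Defensive.

Import Order.TTheory GRing.Theory Num.Theory.

Local Open Scope classical_set_scope.
Local Open Scope card_scope.
Local Open Scope ring_scope.

(** * Cardinals *)

(** A relation is easier to supply than a function: no value has to be invented outside [A], and [U]
    may be empty. Choice turns it into an injection between the subtypes. *)
Lemma card_le_relP (T U : Type) (A : set T) (B : set U) :
  A #<= B <->
  exists r : T -> U -> Prop, (forall x, A x -> exists2 y, B y & r x y) /\
    forall x x' y, A x -> A x' -> r x y -> r x' y -> x = x'.
Proof.
split=> [/card_leP[f]|[r [rt ri]]].
  exists (fun x y => exists h : x \in A,
    y = val (f (SigSub h))).
  split=> [x Ax|x x' y _ _ [h ->] [h' /val_inj]].
    by exists (val (f (SigSub (mem_set Ax)))); [exact: set_valP|exists (mem_set Ax)].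
  by move=> e; have [] := @inj _ _ _ f _ _ (mem_set I) (mem_set I) e.
have /choice[g gP] (x : set_type A) : exists y : set_type B, r (val x) (val y).
  have [y By rxy] := cid2 (rt _ (set_valP x)).
  by exists (SigSub (mem_set By)).
have gi : injective g.
  move=> x y gxy; apply/val_inj/(ri _ _ (val (g x))); rewrite ?gxy //;
    [exact: set_valP|exact: set_valP|by rewrite -gxy].
by apply/card_leP/injfunPex; exists g => // x y _ _ /gi.
Qed.

Lemma card_le_fun (T U : Type) (A : set T) (B : set U) (f : T -> U) :
  (forall x, A x -> B (f x)) -> {in A &, injective f} -> A #<= B.
Proof.
move=> AB fi; apply/card_le_relP; exists (fun x y => f x = y).
split=> [x /AB ?|x x' y Ax Ax' <-]; first by exists (f x).
by move/fi => -> //; exact: mem_set.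
Qed.

Lemma card_leTP (T U : Type) :
  [set: T] #<= [set: U] <-> exists f : T -> U, injective f.
Proof.
split=> [/card_le_relP[r [rt ri]]|[f fi]].
  have /choice[f fP] x : exists y, r x y.
    by have [y _ ?] := cid2 (rt x I); exists y.
  by exists f => x y fxy; apply: (ri _ _ (f x)) => //; rewrite fxy.
by apply: (card_le_fun (f := f)) => // x y _ _; exact: fi.
Qed.

Lemma card_le_setX (T U T' U' : Type) (A : set T) (B : set U) (A' : set T')
    (B' : set U') :
  A #<= A' -> B #<= B' -> A `*` B #<= A' `*` B'.
Proof.
move=> /card_le_relP[r [rt ri]] /card_le_relP[q [qt qi]]; apply/card_le_relP.
exists (fun x y => r x.1 y.1 /\ q x.2 y.2); split=> [[x x'] [/= Ax Bx]|].
  by have [[y ? ?] [y' ? ?]] := (rt x Ax, qt x' Bx); exists (y, y').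
move=> [x x'] [y y'] [z z'] [/= ? ?] [/= ? ?] [/= ? ?] [/= ? ?].
by rewrite (ri x y z) // (qi x' y' z').
Qed.

Lemma card_le_lt_trans (T U V : Type) (B : set U) (A : set T) (C : set V) :
  A #<= B -> B #< C -> A #< C.
Proof.
by move=> AB [BC nCB]; split=> [|CA]; [exact: card_le_trans AB BC|exact/nCB/(card_le_trans CA)].
Qed.

Lemma card_lt_le_trans (T U V : Type) (B : set U) (A : set T) (C : set V) :
  A #< B -> B #<= C -> A #< C.
Proof.
by move=> [AB nBA] BC; split=> [|CA]; [exact: card_le_trans AB BC|exact/nBA/(card_le_trans BC)].
Qed.

(** * Well-orders and comparability of cardinals *)

Section WellOrder.
Variables (T : Type) (le : rel T).
Hypothesis wo : well_order le.

Lemma well_order_min (P : T -> Prop) x : P x ->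
  exists2 z, P z & forall y, P y -> le z y.
Proof.
move=> Px; have [|z [[zP zmin] _]] := wo (A := fun y => `[< P y >]).
  by exists x; apply/asboolP.
exists z => [|y Py]; first exact/asboolP.
by apply: zmin; apply/asboolP.
Qed.

Lemma well_order_total : total le.
Proof.
move=> x y; have [|z zP zmin] := @well_order_min (fun t => t = x \/ t = y) x; first by left.
by case: zP zmin => -> zmin; rewrite zmin ?orbT; auto.
Qed.

Lemma well_order_refl : reflexive le.
Proof. by move=> x; have /orP[] := well_order_total x x. Qed.

(** Two points that lie below each other are both least in the pair they form, and least elements
    are unique by definition of [well_order]. *)
Lemma well_order_anti : antisymmetric le.
Proof.
move=> x y /andP[xy yx].
have [|z [_ zU]] := wo (A := fun t => `[< t = x \/ t = y >]).
  by exists x; apply/asboolP; left.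
have xx := well_order_refl x; have yy := well_order_refl y.
have zx : z = x by apply: zU; split; [apply/asboolP; left|move=> t /asboolP[] ->].
have zy : z = y by apply: zU; split; [apply/asboolP; right|move=> t /asboolP[] ->].
by rewrite -zx zy.
Qed.

Lemma well_order_trans : transitive le.
Proof.
move=> y x z xy yz.
have [m] := @well_order_min (fun t => [\/ t = x, t = y | t = z]) x (Or31 _ _ erefl).
move=> mP mmin; have := mmin x (Or31 _ _ erefl).
have my := mmin y (Or32 _ _ erefl); have mz := mmin z (Or33 _ _ erefl).
case: mP my mz => -> // my mz mx.
  by have -> // : x = y; apply: well_order_anti; rewrite xy mx.
have zy : y = z by apply: well_order_anti; rewrite yz my.
by rewrite -zy.
Qed.

Lemma well_order_wf : well_founded (fun x y => ~~ le y x).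
Proof.
move=> x; apply: contrapT => nx.
have [z nz zmin] := @well_order_min (fun x => ~ Acc (fun x y => ~~ le y x) x) x nx.
apply: nz; constructor=> y nzy; apply: contrapT => /zmin zy.
by rewrite zy in nzy.
Qed.

Lemma well_order_closed_seg m :
  [set b | le b m] = [set b | ~~ le m b] `|` [set m].
Proof.
apply/seteqP; split=> [b /= bm|b /= [nmb|->]]; last exact: well_order_refl.
  have [->|bNm] := pselect (b = m); [by right|left; apply/negP => mb].
  by apply: bNm; apply: well_order_anti; rewrite bm mb.
by have := well_order_total m b; rewrite (negbTE nmb).
Qed.

Lemma well_order_sub (T' : Type) (f : T' -> T) : injective f ->
  well_order (fun x y => le (f x) (f y)).
Proof.
move=> fi A [x Ax].
have [|z [y Ay <-] zmin] := @well_order_min (fun t => exists2 y, y \in A & f y = t) (f x).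
  by exists x.
exists y; split; first by split=> // t At; apply: zmin; exists t.
move=> t [At tmin]; apply/fi/well_order_anti; rewrite tmin // andbT.
by apply: zmin; exists t.
Qed.

End WellOrder.

Lemma well_order_leq : well_order leq.
Proof.
apply: antisymmetric_well_order; first exact: anti_leq.
move=> A [n An]; have ex : exists n, n \in A by exists n.
by exists (ex_minn ex); case: ex_minnP => m Am mmin; split=> // k /mmin.
Qed.

Definition wo (T : Type) : {R : rel T | well_order R} :=
  well_ordering_principle {classic T}.

(* Map the points of [Z] one after the other to points of [Y] that were not
   used yet; the hypothesis says that there are such points at every stage. *)
Lemma card_le_wf (Z Y : Type) (lt : Z -> Z -> Prop) :
  well_founded lt -> (forall x y, x <> y -> lt x y \/ lt y x) ->
  (forall z, ~ ([set: Y] #<= [set y | lt y z])) -> [set: Z] #<= [set: Y].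
Proof.
move=> wf tot big.
(* If every point of [Y] had been used before stage [z], sending each point to a stage that used it
   would inject [Y] into the predecessors of [z]. *)
have pick z (g : forall y, lt y z -> Y) : {t : Y | forall y h, g y h <> t}.
  apply: cid; apply: contrapT => /forallNP none; apply: (big z).
  apply/card_le_relP; exists (fun t y => exists h, g y h = t); split=> [t _|].
    have /existsNP[y /existsNP[h /contrapT gt]] := none t.
    by exists y => //; exists h.
  by move=> t t' y _ _ [h <-] [h' <-]; rewrite (Prop_irrelevance h h').
pose F := Fix wf (fun _ => Y) (fun z g => sval (pick z g)).
have FE z : F z = sval (pick z (fun y _ => F y)).
  rewrite {1}/F Fix_eq // => x f g fg; congr (sval (pick x _)).
  by apply: functional_extensionality_dep => y; apply: funext => h; exact: fg.
have Flt y z : lt y z -> F y <> F z.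
  by move=> yz; rewrite (FE z); case: (pick z _) => t /= /(_ y yz).
apply/card_leTP; exists F => x y Fxy; apply: contrapT => /tot[/Flt/(_ Fxy)//|].
by move/Flt/(_ (esym Fxy)).
Qed.

Lemma card_le_wo (Z Y : Type) (le : rel Z) : well_order le ->
  (forall z, ~ ([set: Y] #<= [set y | ~~ le z y])) -> [set: Z] #<= [set: Y].
Proof.
move=> lewo; apply: card_le_wf (well_order_wf lewo) _ => x y xy.
have := @well_order_anti _ _ lewo x y.
by case: (le x y) => /= [|_]; [case: (le y x) => /= [/(_ isT)|]; [|left]|right].
Qed.

(** If [B] does not inject into [A], it injects into no initial segment of a well-order of [A], so
    [card_le_wo] maps [A] into [B]. *)
Lemma card_le_total (T U : Type) (A : set T) (B : set U) : A #<= B \/ B #<= A.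
Proof.
rewrite -(card_le_eql (card_setT A)) -(card_le_eqr (card_setT B)).
rewrite -(card_le_eql (card_setT B)) -(card_le_eqr (card_setT A)).
have [|nBA] := pselect ([set: B] #<= [set: A]); first by right.
left; have [le lewo] := wo A; apply: (card_le_wo lewo) => z /card_le_trans h.
by apply/nBA/h/card_leT.
Qed.

Lemma card_ltNge (T U : Type) (A : set T) (B : set U) : ~ (B #<= A) -> A #< B.
Proof. by move=> nBA; split=> //; have [|/nBA] := card_le_total A B. Qed.

(** Hilbert's hotel: a copy [f] of the integers in [A] is shifted by one, which frees [f 0] for
    [x]. *)
Lemma card_le_setU1 (T : Type) (A : set T) x :
  [set: nat] #<= A -> A `|` [set x] #<= A.
Proof.
move=> /card_le_relP[r [rt ri]].
have /choice[f fP] n : exists y, A y /\ r n y.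
  by have [y ? ?] := cid2 (rt n I); exists y.
have fi : injective f.
  move=> m n fmn; have [[_ rm] [_ rn]] := (fP m, fP n).
  by apply: (ri _ _ (f m)) => //; rewrite fmn.
have [Ax|nAx] := pselect (A x); first by apply: subset_card_le => y [|->].
have /choice[h hP] y : exists o : option nat,
    if o is Some n then y = f n else forall n, y <> f n.
  have [[n yn]|nf] := pselect (exists n, y = f n).
    by exists (Some n).
  by exists None => n yn; apply: nf; exists n.
pose g y := if h y is Some n then f n.+1 else if pselect (y = x) then f 0%N else y.
apply: (card_le_fun (f := g)) => [y Ay|y y' _ _].
  rewrite /g; case: (h y) (hP y) => [n _|_]; first by case: (fP n.+1).
  by case: pselect => yx; [case: (fP 0%N)|case: Ay].
rewrite /g; case: (h y) (hP y) => [n ->|nf]; case: (h y') (hP y') => [n' ->|nf'].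
- by move/fi => [->].
- by case: (pselect (y' = x)) => [_ /fi//|_ /esym/nf'].
- by case: (pselect (y = x)) => [_ /fi//|_ /nf].
case: (pselect (y = x)) => yx; case: (pselect (y' = x)) => y'x //=.
- by rewrite yx y'x.
- by move/esym/nf'.
by move/nf.
Qed.

(** * The square of an infinite set has the cardinality of the set *)

Section Square.
Variables (T : Type) (le : rel T).
Hypothesis lewo : well_order le.

Let seg m : set T := [set b | ~~ le m b].

Let segP m b : seg m b <-> le b m /\ b <> m.
Proof.
rewrite /seg /=; split=> [nmb|[bm bNm]].
  have := well_order_total lewo m b; rewrite (negbTE nmb) /= => bm; split=> // bE.
  by rewrite bE (well_order_refl lewo) in nmb.
by apply/negP => mb; apply: bNm; apply: (well_order_anti lewo); rewrite bm mb.
Qed.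

Let maxo (z : T * T) := if le z.1 z.2 then z.2 else z.1.

Let maxoP z : le z.1 (maxo z) /\ le z.2 (maxo z).
Proof.
rewrite /maxo; case: ifPn => [h|h]; rewrite (well_order_refl lewo) //.
by split=> //; have := well_order_total lewo z.1 z.2; rewrite (negbTE h).
Qed.

(* The pairs are ordered by their maximum first, and arbitrarily among those
   with the same maximum: the predecessors of a pair with maximum [m] lie in
   the square of the closed segment of [m]. *)
Let card_square_sub (A : set T) :
  (forall m b, A m -> le b m -> A b) -> [set: nat] #<= A ->
  (forall m, A m -> [set: nat] #<= seg m -> seg m `*` seg m #<= seg m) ->
  (forall m, A m -> ~ (A #<= seg m)) -> A `*` A #<= A.
Proof.
move=> Adown Ainf IH Asmall; have [q qwo] := wo (T * T)%type.
pose lt (z z' : T * T) := ~~ le (maxo z') (maxo z) \/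
  (maxo z = maxo z' /\ ~~ q z' z).
have lewf := well_order_wf lewo; have qwf := well_order_wf qwo.
have ltwf : well_founded lt.
  move=> z; have [m mE] : exists m, m = maxo z by eexists.
  elim: (lewf m) z mE => {}m _ IHm z; elim: (qwf z) => {}z _ IHz zE.
  constructor=> y [yz|[yz nzy]]; first by apply: (IHm (maxo y)); rewrite ?zE.
  by apply: IHz => //; rewrite yz.
have lttot z z' : z <> z' -> lt z z' \/ lt z' z.
  rewrite /lt => zz'; have := @well_order_anti _ _ lewo (maxo z) (maxo z').
  have := @well_order_anti _ _ qwo z z'.
  case: (le (maxo z) (maxo z')) => /=; last by right; left.
  case: (le (maxo z') (maxo z)) => /=; last by left; left.
  case: (q z z') => /=; last by move=> _ /(_ isT); right; right.
  case: (q z' z) => /=; last by move=> _ /(_ isT); left; right.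
  by move=> /(_ isT).
rewrite -(card_le_eql (card_setT _)) -(card_le_eqr (card_setT A)).
have wf' : well_founded (fun x y : set_type (A `*` A) => lt (val x) (val y)).
  move=> x; have [z zE] : exists z, z = val x by eexists.
  elim: (ltwf z) x zE => {}z _ IHz x zE; constructor=> y yx.
  by apply: (IHz (val y)); rewrite ?zE.
apply: (card_le_wf wf') => [x y xy|z zbig].
  by apply: lttot => /val_inj.
have [Az1 Az2] := set_valP z; set m := maxo (val z).
have Am : A m by rewrite /m /maxo; case: ifP.
have {zbig} Abig : A #<= [set b | le b m] `*` [set b | le b m].
  rewrite -(card_le_eql (card_setT A)); apply: card_le_trans zbig _.
  apply: (card_le_fun (f := val)) => [y /= yz|]; last by move=> ? ? _ _ /val_inj.
  have [y1 y2] := maxoP (val y).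
  have ym : le (maxo (val y)) m.
    case: yz => [|[-> _]]; last exact: well_order_refl.
    by have := well_order_total lewo (maxo (val y)) m => /orP[//|->].
  by split; apply: (well_order_trans lewo) ym.
have clE := well_order_closed_seg lewo m.
(* [A] injects into the square of the closed segment of [m]. A finite segment contradicts that [A]
   is infinite; for an infinite one the extra endpoint is absorbed and [IH] gives an injection of
   [A] into [seg m], against [Asmall]. *)
have [sfin|sinf] := pselect (finite_set (seg m)).
  have /finite_setPn : finite_set ([set b | le b m] `*` [set b | le b m]).
    by apply: finite_setX; rewrite clE finite_setU.
  by apply; apply: card_le_trans Abig.
move/infiniteP: sinf => sinf; apply: (Asmall m) => //.
apply: (card_le_trans Abig); apply: card_le_trans (IH m Am sinf).
by apply: card_le_setX; rewrite clE; exact: card_le_setU1.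
Qed.

(** By induction on [a]: either [seg a] injects into a smaller segment and inherits the property
    from it, or it injects into none, as an initial ordinal does, and [card_square_sub] applies. *)
Let card_square_seg a : [set: nat] #<= seg a -> seg a `*` seg a #<= seg a.
Proof.
elim: (well_order_wf lewo a) => {}a _ IH ainf.
have [[m ma am]|small] := pselect (exists2 m, seg a m & seg a #<= seg m).
  have ms : seg m `*` seg m #<= seg m by apply: IH => //; exact: card_le_trans am.
  have mas : seg m `<=` seg a.
    move=> b /segP[bm bNm]; apply/segP; have /segP[ma' maN] := ma.
    have ba := well_order_trans lewo bm ma'; split=> // bE; apply: bNm.
    by apply: (well_order_anti lewo); rewrite bm bE ma'.
  apply: card_le_trans (subset_card_le mas); apply: card_le_trans ms.
  exact: card_le_setX.
apply: card_square_sub => //.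
  move=> m b /segP[ma maN] bm; apply/segP; have ba := well_order_trans lewo bm ma.
  by split=> // bE; apply: maN; apply: (well_order_anti lewo); rewrite ma -bE bm.
by move=> m am asm; apply: small; exists m.
Qed.

Lemma card_square_wo : [set: nat] #<= [set: T] -> [set: T] `*` [set: T] #<= [set: T].
Proof.
move=> Tinf.
have [[m Tm]|small] := pselect (exists m, [set: T] #<= seg m).
  have mm := card_square_seg (card_le_trans Tinf Tm).
  apply: card_le_trans (card_le_setX Tm Tm) _; apply: card_le_trans mm _.
  exact: card_leT.
apply: card_square_sub => // [m _|m _ Tm]; first exact: card_square_seg.
by apply: small; exists m.
Qed.

End Square.

Lemma card_square (T : Type) : [set: nat] #<= [set: T] -> [set: T * T] #<= [set: T].
Proof.
have [le lewo] := wo T; move/(card_square_wo lewo); apply: card_le_trans.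
by apply: subset_card_le => -[].
Qed.

Lemma card_le_sig (I K : Type) (F : I -> Type) : [set: nat] #<= [set: K] ->
  [set: I] #<= [set: K] -> (forall i, [set: F i] #<= [set: K]) ->
  [set: {i & F i}] #<= [set: K].
Proof.
move=> Kinf /card_leTP[f fi] FK; apply: card_le_trans (card_square Kinf).
have /all_sig[g gi] i : {f : F i -> K | injective f} by exact/cid/card_leTP.
apply/card_leTP; exists (fun x => (f (tag x), g _ (tagged x))).
move=> [i x] [j y] /= [/fi ij]; move: ij y => <- y.
by move/gi => ->.
Qed.

(** * Successor and regular cardinals *)

Lemma card_gt_succ (l k m : small) : is_successor l k -> [set: m] #< [set: k] ->
  [set: m] #<= [set: l].
Proof.
move=> [lk ksucc] [_ nkm]; apply: contrapT => nml.
by apply/nkm/ksucc/card_ltNge.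
Qed.

(** Fewer than [k] means at most [l], and a sum of at most [l] sets of size at most [l] fits into
    the square of [l]. *)
Lemma regular_successor (l k : small) : infinite l -> is_successor l k -> regular k.
Proof.
move=> linf lk; have [[lk1 lk2] _] := lk.
split=> [|I F Ik Fk]; first exact: card_le_trans lk1.
apply: card_le_lt_trans (proj1 lk); apply: card_le_sig => //.
  exact: card_gt_succ Ik.
by move=> i; exact: card_gt_succ (Fk i).
Qed.

(** Hartogs' construction inside a well-order of [l]: the successor of [a] is the set [V] of points
    whose initial segments have size at most [a]. Segments of [V] are too small to hold any [m]
    larger than [a], so [V] injects into [m]. *)
Lemma successor_below (a l : small) : [set: a] #< [set: l] ->
  exists2 k : small, is_successor a k & [set: k] #<= [set: l].
Proof.
move=> [al nla]; have [le lewo] := wo l.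
pose V : set l := [set b | [set c | ~~ le b c] #<= [set: a]].
have nVa : ~ (V #<= [set: a]).
  (* [V] is not everything, as [l] exceeds [a]; but the segment of the first point outside lies in
     [V], which would put that point into [V]. *)
  move=> Va; have [[x nVx]|nV] := pselect (exists x, ~ V x); last first.
    apply: nla; apply: card_le_trans Va; apply: subset_card_le => x _.
    by apply: contrapT => nVx; apply: nV; exists x.
  have [y nVy ymin] := well_order_min lewo (P := fun x => ~ V x) nVx.
  apply: nVy; apply: card_le_trans Va; apply: subset_card_le => c /= nyc.
  by apply: contrapT => /ymin yc; rewrite yc in nyc.
exists V; last by rewrite (card_le_eql (card_setT V)); exact: card_leT.
split; first by apply: card_ltNge; rewrite (card_le_eql (card_setT V)).
move=> m [am nma].
apply: (card_le_wo (well_order_sub lewo (f := val) val_inj)) => z mz; apply: nma.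
apply: (card_le_trans mz); apply: card_le_trans (set_valP z).
by apply: (card_le_fun (f := val)) => // x y _ _ /val_inj.
Qed.

(** Regularity for a family indexed by [bool]. *)
Lemma card_lt_sum (k A B : small) : regular k -> uncountable k ->
  [set: A] #< [set: k] -> [set: B] #< [set: k] -> [set: (A + B)%type] #< [set: k].
Proof.
move=> [kinf kreg] kunc Ak Bk.
have boolk : [set: bool] #< [set: k].
  by apply: card_ltNge => /sub_countable h; apply/kunc/h/countableP.
apply: card_le_lt_trans (kreg bool (fun b => if b then A else B) boolk _); last by case.
apply/card_leTP; exists (fun x : A + B => match x with
  | inl y => existT (fun b : bool => if b then A else B) true y
  | inr y => existT (fun b : bool => if b then A else B) false y end).
apply: (@can_inj _ _ _ (fun z => (if tag z as b return (if b then A else B) -> A + B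
  then @inl A B else @inr A B) (tagged z))).
by case.
Qed.

(* One step of the closure of [S] under [f] maps pairs, so it does not raise an
   infinite cardinality. *)
Lemma card_closure (T K : Type) (f : T -> T -> T) (S : set T) :
  [set: nat] #<= [set: K] -> S #<= [set: K] -> (forall x, f x x = x) ->
  exists2 C : set T, S `<=` C &
    C #<= [set: K] /\ forall x y, C x -> C y -> C (f x y).
Proof.
move=> Kinf SK fxx.
pose C := fix C n : set T := if n is n'.+1 then
  [set z | exists x y, [/\ C n' x, C n' y & z = f x y]] else S.
(* Idempotence of [f] makes each stage contain the previous one. *)
have CS n : C n `<=` C n.+1 by move=> x Cx; exists x, x; rewrite fxx.
have Cmono m n : (m <= n)%N -> C m `<=` C n.
  elim: n => [|n IH]; first by rewrite leqn0 => /eqP->.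
  by rewrite leq_eqVlt => /orP[/eqP->//|/IH mn x /mn]; exact: CS.
have CK n : C n #<= [set: K].
  elim: n => // n IH; apply: card_le_trans (card_square Kinf).
  apply: (@card_le_trans _ _ _ (C n `*` C n)).
    apply: (@card_le_trans _ _ _ ((fun z => f z.1 z.2) @` (C n `*` C n))).
      by apply: subset_card_le => _ [x [y [Cx Cy ->]]]; exists (x, y).
    exact: card_image_le.
  by apply: card_le_trans (card_le_setX IH IH) _; exact: subset_card_le.
exists (\bigcup_n C n); first by move=> x Sx; exists 0%N.
split.
- have : [set: {n & set_type (C n)}] #<= [set: K].
    by apply: card_le_sig => // n; rewrite (card_le_eql (card_setT _)).
  apply: card_le_trans.
  apply: (@card_le_trans _ _ _ ((fun x : {n & set_type (C n)} => val (tagged x)) @` setT)).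
    apply: subset_card_le => x [n _ Cx].
    by exists (existT (fun n => set_type (C n)) n (SigSub (mem_set Cx))).
  exact: card_image_le.
- move=> x y [m _ Cx] [n _ Cy]; exists (maxn m n).+1 => //.
  by exists x, y; split=> //; [apply: Cmono Cx|apply: Cmono Cy]; rewrite leq_max leqnn ?orbT.
Qed.

(** * Embeddings and directed completions *)

Section Metric.
Variable R : realType.
Implicit Types X Y : metricType R.

Lemma closure_mdistP X (A : set X) x :
  closure A x <-> forall e : R, 0 < e -> exists2 y, A y & mdist x y < e.
Proof.
split=> [clA e e0|near_x B /nbhs_ballP[e /= e0 xB]].
  have /clA[y [Ay]] : nbhs x (ball x e) by apply: nbhsx_ballx.
  by rewrite ballEmdist => xy; exists y.
by have [y Ay xy] := near_x e e0; exists y; split=> //; apply: xB; rewrite ballEmdist.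
Qed.

Lemma dense_closure X (A : set X) : dense A -> forall x, closure A x.
Proof.
move=> dA x B; rewrite nbhsE => -[O [Oo Ox] OB].
by have [|y [Oy Ay]] := dA O _ Oo; [exists x|exists y; split=> //; exact: OB].
Qed.

(** The sets of points whose images are close to [x] generate a Cauchy filter, because [g] preserves
    distances; its limit is sent to [x]. *)
Lemma isometry_closed X Y (g : Y -> X) : is_complete Y ->
  (forall y y', mdist (g y) (g y') = mdist y y') ->
  closure (range g) `<=` range g.
Proof.
move=> Yc gd x /closure_mdistP xg.
pose F : set_system Y := [set A | exists2 e : R, 0 < e & forall y, mdist x (g y) < e -> A y].
have FF : ProperFilter F.
  apply: Build_ProperFilter_ex.
    by move=> A [e e0 eA]; have [_ [y _ <-] /eA] := xg e e0; exists y.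
  split; first by exists 1.
    move=> A B [e e0 eA] [d d0 dB]; exists (Num.min e d); first by rewrite lt_min e0.
    by move=> y; rewrite lt_min => /andP[/eA ? /dB].
  by move=> A B AB [e e0 eA]; exists e => // y /eA/AB.
have [|y Fy] := Yc F FF.
  apply: cauchy_exP => e e0; have e2 : 0 < e / 2 by rewrite divr_gt0.
  have [_ [y _ <-] xy] := xg _ e2; exists y; exists (e / 2) => // y' xy'.
  rewrite ballEmdist /= -gd; apply: le_lt_trans (metric_triangle _ x _) _.
  by rewrite metric_sym [e]splitr ltrD.
exists y => //; apply: mdist_positivity; apply/eqP; rewrite eq_le mdist_ge0 andbT.
apply/ler_addgt0Pl => e e0; rewrite addr0.
have [|d d0 dy] := Fy (ball y (e / 2)); first by apply: nbhsx_ballx; rewrite divr_gt0.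
have [|_ [z _ <-]] := xg (Num.min d (e / 2)); first by rewrite lt_min d0 divr_gt0.
rewrite lt_min => /andP[/dy]; rewrite ballEmdist /= -gd => yz zx.
apply: le_trans (metric_triangle _ (g z) _) _.
by rewrite [e]splitr lerD ?ltW // metric_sym.
Qed.

End Metric.

Section EmbeddingTheory.
Variables (R : realType) (L : language).
Implicit Types M N P : structure R L.

Lemma emb_mdist M N (f : embedding M N) s (x y : car M s) :
  mdist (f s x) (f s y) = mdist x y.
Proof. by case: s x y => [s|] x y //; exact: emb_dist. Qed.

Lemma emb_inj M N (f : embedding M N) s : injective (f s).
Proof.
move=> x y fxy; apply: mdist_positivity.
by rewrite -(emb_mdist f) fxy mdistxx.
Qed.

Lemma comp_embA M N P Q (h : embedding P Q) (g : embedding N P) (f : embedding M N) :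
  comp_emb h (comp_emb g f) = comp_emb (comp_emb h g) f.
Proof. by apply: emb_eq => s x; rewrite !comp_embE. Qed.

Lemma comp_id_emb M N (f : embedding M N) : comp_emb (id_emb N) f = f.
Proof. by apply: emb_eq => s x; rewrite comp_embE id_embE. Qed.

Lemma comp_emb_inj M N P (g : embedding N P) (f f' : embedding M N) :
  comp_emb g f = comp_emb g f' -> f = f'.
Proof.
move=> gf; apply: emb_eq => s x; apply: (@emb_inj _ _ g).
by rewrite -!comp_embE gf.
Qed.

(** On the real sort an embedding is the identity, so its range is everything; the other sorts are
    complete. *)
Lemma emb_range_closed M N (f : embedding M N) s : closure (range (f s)) `<=` range (f s).
Proof.
case: s => [s|]; last by move=> x _; exists x.
by apply: isometry_closed; [exact: str_complete|exact: emb_mdist].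
Qed.

(** The factor is built pointwise; since [g] is an injective isometry that preserves the whole
    structure, each condition on [h] follows from that on [f] by cancelling [g]. *)
Lemma emb_factor M N P (f : embedding M P) (g : embedding N P) :
  (forall s, range (f s) `<=` range (g s)) ->
  exists h : embedding M N, comp_emb g h = f.
Proof.
move=> fg; have /all_sig[h hP] (s : Lsort L) :
    {h : str_sort M s -> str_sort N s | forall x, emb_fun g (h x) = emb_fun f x}.
  have /choice[h hP] x : exists y, emb_fun g y = @emb_fun _ _ _ _ f s x.
    by have [|y _ <-] := fg (Some s) (emb_fun f x); [exists x|exists y].
  by exists h.
have hE s (x : car M s) : g s (@map_interp _ _ M N h s x) = f s x by case: s x.
have htE n (d : 'I_n -> option (Lsort L)) (a : forall i, car M (d i)) :
    (fun i => g (d i) (@map_interp _ _ M N h (d i) (a i))) = (fun i => f (d i) (a i)).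
  by apply: functional_extensionality_dep => i; exact: hE.
have h1 c : @map_interp _ _ M N h _ (str_const M c) = str_const N c.
  by apply: (@emb_inj _ _ g); rewrite hE /emb_app !emb_const.
have h2 s (x y : str_sort M s) : mdist (h s x) (h s y) = mdist x y.
  by rewrite -(emb_dist g) !hP emb_dist.
have h3 u (a : forall i, car M (fun_dom u i)) :
    @map_interp _ _ M N h _ (str_fun a) =
    str_fun (fun i => @map_interp _ _ M N h _ (a i) : car N (fun_dom u i)).
  by apply: (@emb_inj _ _ g); rewrite hE /emb_app !emb_funP htE.
have h4 r (a : forall i, car M (rel_dom r i)) (k : R) : 0 <= k <= 1 ->
    dist_to a (@str_rel _ _ M r @^-1` [set k]) =
    dist_to (fun i => @map_interp _ _ M N h _ (a i) : car N (rel_dom r i))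
      (@str_rel _ _ N r @^-1` [set k]).
  by move=> k01; rewrite (emb_rel f _ k01) (emb_rel g _ k01) htE.
exists (Embedding h1 h2 h3 h4); apply: emb_eq => s x.
by rewrite comp_embE; exact: hE.
Qed.

Variable K : mAEC R L.

(** Invariance under isomorphism, applied to [id_emb M] and the square whose sides are [id_emb M]
    and [f]. *)
Lemma leK_iso_emb M N (f : embedding M N) : inK K M -> is_iso f -> leK K f.
Proof.
move=> MK fi; apply: (@leK_iso _ _ K M M M N (id_emb M) f (id_emb M) f) => //.
  by move=> s; exists id => x; rewrite id_embE.
exact: leK_refl.
Qed.

Lemma leK_factor M N P (f : embedding M P) (g : embedding N P) :
  leK K f -> leK K g -> (forall s, range (f s) `<=` range (g s)) ->
  exists2 h : embedding M N, comp_emb g h = f & leK K h.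
Proof.
move=> fK gK /emb_factor[h hP]; exists h => //.
by apply: leK_coherence gK _; rewrite hP.
Qed.

End EmbeddingTheory.

(** * Completions of directed systems *)

Section Completion.
Variables (R : realType) (L : language) (K : mAEC R L).
Variables (J : small) (le : rel J) (M : J -> structure R L).
Variable m : forall i j, le i j -> embedding (M i) (M j).
Hypothesis le_refl : reflexive le.
Hypothesis le_trans : transitive le.
Hypothesis m1 : forall i (h : le i i), m h = id_emb (M i).
Hypothesis mM : forall i j k (hij : le i j) (hjk : le j k) (hik : le i k),
  comp_emb (m hjk) (m hij) = m hik.
Hypothesis mK : forall i j (h : le i j), leK K (m h).

(** The legs take a proof of membership, so that completions over nested subsets of [J] compare
    without subtypes. Uniqueness in [compl_univ] is left out, as it follows from density by
    [emb_eq_dense]. *)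
Record completion (A : set J) (U : structure R L) (u : forall i, A i -> embedding (M i) U) :
    Prop := Completion {
  compl_compat : forall i j hi hj (h : le i j), comp_emb (u j hj) (m h) = u i hi;
  compl_dense : forall s (x : car U s) (e : R), 0 < e ->
    exists i hi y, mdist x (u i hi s y) < e;
  compl_leK : forall i hi, leK K (u i hi);
  compl_univ : forall (N : structure R L) (f : forall i, A i -> embedding (M i) N),
    (forall i j hi hj (h : le i j), comp_emb (f j hj) (m h) = f i hi) ->
    (forall i hi, leK K (f i hi)) ->
    exists2 g : embedding U N, forall i hi, comp_emb g (u i hi) = f i hi & leK K g
}.

Definition has_completion (A : set J) : Prop :=
  exists U (u : forall i, A i -> embedding (M i) U), completion u.

Lemma emb_eq_dense (A : set J) U N (u : forall i, A i -> embedding (M i) U)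
    (g g' : embedding U N) :
  (forall s (x : car U s) (e : R), 0 < e -> exists i hi y, mdist x (u i hi s y) < e) ->
  (forall i hi, comp_emb g (u i hi) = comp_emb g' (u i hi)) -> g = g'.
Proof.
move=> udense gg'; apply: emb_eq => s x; apply: mdist_positivity.
apply/eqP; rewrite eq_le mdist_ge0 andbT; apply/ler_addgt0Pl => e e0; rewrite addr0.
have [|i [hi [y xy]]] := udense s x (e / 2); first by rewrite divr_gt0.
apply: Order.POrderTheory.le_trans (metric_triangle _ (g s (u i hi s y)) _) _.
rewrite emb_mdist -comp_embE gg' comp_embE emb_mdist [X in _ + X <= _]metric_sym.
by rewrite [e]splitr lerD ?ltW.
Qed.

Lemma has_completion_top (A : set J) t : A t -> (forall i, A i -> le i t) ->
  has_completion A.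
Proof.
move=> At Ale; exists (M t), (fun i hi => m (Ale i hi)).
split=> [i j hi hj h|s x e e0|i hi|N f fm fK]; first exact: mM.
- by exists t, At, x; rewrite m1 id_embE mdistxx.
- exact: mK.
- by exists (f t At) => [i hi|]; [exact: fm|exact: fK].
Qed.

(** The completions of the stages form a chain of K-embeddings, and the chain axiom completes that
    chain. *)
Lemma has_completion_chain (W : small) (lew : rel W) (S : W -> set J) :
  inhabited W -> well_order lew ->
  (forall v w, lew v w -> S v `<=` S w) ->
  (forall w, has_completion (S w)) -> has_completion (\bigcup_w S w).
Proof.
move=> W0 wo Smono /(fun h w => cid (h w))/all_sig[U].
move=> /(fun h w => cid (h w))/all_sig[u uP].
(* The legs of [U w] restricted to [S v] factor through [U v]. Density makes these connecting maps
   unique, hence functorial. *)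
have n_ex v w (h : lew v w) : {n : embedding (U v) (U w) |
    (forall i hi, comp_emb n (u v i hi) = u w i (Smono _ _ h _ hi)) /\ leK K n}.
  apply: cid; have [|i hi|n] := compl_univ (uP v) (f := fun i hi => u w i (Smono _ _ h _ hi)).
  - by move=> i j hi hj hij; exact: compl_compat (uP w) _ _ _ _ _.
  - exact: compl_leK (uP w) _ _.
  - by exists n.
pose n v w h := sval (n_ex v w h).
have nE v w h i hi hi' : comp_emb (n v w h) (u v i hi) = u w i hi'.
  rewrite /n; case: (n_ex v w h) => /= g [-> _].
  by congr (u w i); exact: Prop_irrelevance.
have nK v w h : leK K (n v w h) by rewrite /n; case: (n_ex v w h) => /= g [].
have u_ext v N (g g' : embedding (U v) N) :
    (forall i hi, comp_emb g (u v i hi) = comp_emb g' (u v i hi)) -> g = g'.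
  exact: emb_eq_dense (compl_dense (uP v)).
have n1 w (h : lew w w) : n w w h = id_emb (U w).
  by apply: u_ext => i hi; rewrite (nE _ _ _ _ _ hi) comp_id_emb.
have nM v w x (hvw : lew v w) (hwx : lew w x) (hvx : lew v x) :
    comp_emb (n w x hwx) (n v w hvw) = n v x hvx.
  apply: u_ext => i hi; rewrite -comp_embA.
  by rewrite !(nE _ _ _ _ _ (Smono _ _ hvw _ hi), nE _ _ _ _ _ (Smono _ _ hvx _ hi)).
have [V [v [vn vdense _ vK vuniv]]] := leK_chain W0 wo n1 nM nK.
have vu w w' i hi hi' : comp_emb (v w) (u w i hi) = comp_emb (v w') (u w' i hi').
  have [ww'|w'w] := orP (well_order_total wo w w').
    by rewrite -(vn _ _ ww') -comp_embA (nE _ _ _ _ _ hi').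
  by rewrite -(vn _ _ w'w) -comp_embA (nE _ _ _ _ _ hi).
(* The leg at [i] passes through a chosen stage containing [i]; by [vu] the choice is immaterial. *)
have pick i (hi : (\bigcup_w S w) i) : {w | S w i} by apply: cid; case: hi => w; exists w.
exists V, (fun i hi => comp_emb (v (sval (pick i hi))) (u _ i (svalP (pick i hi)))).
split=> [i j hi hj h|s x e e0|i hi|N f fm fK].
- case: (pick i hi) (pick j hj) => w Swi [w' Sw'j] /=.
  have [ww'|w'w] := orP (well_order_total wo w w').
    rewrite -comp_embA (compl_compat (uP w') (Smono _ _ ww' _ Swi)) //; exact: vu.
  rewrite (vu w' w _ _ (Smono _ _ w'w _ Sw'j)) -comp_embA.
  by rewrite (compl_compat (uP w) Swi).
- have e2 : 0 < e / 2 by rewrite divr_gt0.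
  have /closure_mdistP clx := dense_closure (vdense s) (x := x).
  have [_ [w _ [y _ <-]] xy] := clx _ e2.
  have [i [hi [z yz]]] := compl_dense (uP w) y e2.
  have Si : (\bigcup_w S w) i by exists w.
  exists i, Si, z; rewrite (vu _ w _ _ hi) comp_embE.
  apply: le_lt_trans (metric_triangle _ (v w s y) _) _.
  by rewrite emb_mdist [e]splitr ltrD.
- by apply: leK_trans; [exact: compl_leK (uP _) _ _|exact: vK].
have SA w : S w `<=` \bigcup_w S w by move=> i ?; exists w.
have g_ex w : {g : embedding (U w) N |
    (forall i hi, comp_emb g (u w i hi) = f i (SA w i hi)) /\ leK K g}.
  apply: cid; have [|i hi|g] := compl_univ (uP w) (f := fun i hi => f i (SA w i hi)).
  - by move=> i j hi hj hij; exact: fm.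
  - exact: fK.
  - by exists g.
have [||g gv gK] := vuniv N (fun w => sval (g_ex w)).
- move=> w w' ww'; apply: u_ext => i hi.
  rewrite -comp_embA (nE _ _ _ _ _ (Smono _ _ ww' _ hi)).
  case: (g_ex w) (g_ex w') => a [/= -> _] [b [/= -> _]].
  by congr (f i); exact: Prop_irrelevance.
- by move=> w; case: (g_ex w) => a [].
exists g => // i hi; case: (pick i hi) => w Swi /=.
rewrite comp_embA gv; case: (g_ex w) => a [/= -> _].
by congr (f i); exact: Prop_irrelevance.
Qed.

Definition directed_set (A : set J) : Prop :=
  (exists i, A i) /\ forall i j, A i -> A j -> exists k, [/\ A k, le i k & le j k].

(** A cofinal sequence [c] in [A] exhausts [A] by the sets of elements below [c n], each of which
    has a greatest element. *)
Lemma has_completion_countable (A : set J) :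
  directed_set A -> countable A -> has_completion A.
Proof.
move=> [[i0 Ai0] Adir] /card_le_relP[r [rt ri]].
(* [e] enumerates [A] by inverting [r], with default value [i0] at integers that [r] does not reach
   from [A]. *)
have /choice[e eP] n : exists i, A i /\ forall j, A j -> r j n -> i = j.
  have [[j [Aj rjn]]|nj] := pselect (exists j, A j /\ r j n).
    by exists j; split=> // j' Aj' rj'n; apply: (ri _ _ n).
  by exists i0; split=> // j Aj rjn; case: nj; exists j.
have /choice[ub ubP] (ij : J * J) : exists k,
    A ij.1 -> A ij.2 -> [/\ A k, le ij.1 k & le ij.2 k].
  have [[A1 A2]|nA] := pselect (A ij.1 /\ A ij.2).
    by have [k] := Adir _ _ A1 A2; exists k.
  by exists i0 => A1 A2; case: nA.
pose c := fix c n := if n is n'.+1 then ub (c n', e n') else i0.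
have Ac n : A (c n).
  by elim: n => //= n IH; have [] := ubP (c n, e n) IH (proj1 (eP n)).
have cS n : le (c n) (c n.+1) /\ le (e n) (c n.+1).
  by have [] := ubP (c n, e n) (Ac n) (proj1 (eP n)).
have cmono k n : (k <= n)%N -> le (c k) (c n).
  elim: n => [|n IH]; first by rewrite leqn0 => /eqP->.
  rewrite leq_eqVlt => /orP[/eqP->//|/IH kn].
  exact: le_trans kn (proj1 (cS n)).
have -> : A = \bigcup_n [set i | A i /\ le i (c n)].
  apply/seteqP; split=> [i Ai|i [n _ []//]].
  have [n _ rin] := rt i Ai; exists n.+1 => //; split=> //.
  by rewrite -(proj2 (eP n) i Ai rin); exact: (proj2 (cS n)).
apply: (has_completion_chain _ well_order_leq) => [|k n kn i [Ai ik]|n].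
- exact: (inhabits 0%N).
- by split=> //; exact: le_trans ik (cmono _ _ kn).
- by apply: (@has_completion_top _ (c n)) => [|i []].
Qed.

(* Iwamura's lemma: the closures of the segments of a well-ordering of [A] under
   a choice of upper bounds form a chain of smaller directed sets. *)
Lemma has_completion_wo (W : small) (lew : rel W) (A : set J) :
  well_order lew -> A #<= [set: W] ->
  (forall w B, directed_set B -> B #<= [set v | ~~ lew w v] -> has_completion B) ->
  directed_set A -> has_completion A.
Proof.
move=> wo /card_le_relP[r [rt ri]] IH [[i0 Ai0] Adir].
(* Taking [ub (i, i) = i] provides the idempotence that [card_closure] asks for. *)
have /choice[ub ubP] (ij : J * J) : exists k, (ij.1 = ij.2 -> k = ij.1) /\
    (A ij.1 -> A ij.2 -> [/\ A k, le ij.1 k & le ij.2 k]).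
  case: ij => i j /=; have [<-|ij] := pselect (i = j); first by exists i.
  have [[A1 A2]|nA] := pselect (A i /\ A j).
    by have [k] := Adir _ _ A1 A2; exists k.
  by exists i0; split=> // A1 A2; case: nA.
pose closed (D : set J) := forall i j, D i -> D j -> D (ub (i, j)).
(* The point [i0] belongs to every stage, so that no closure is empty. *)
pose X w := [set i | A i /\ exists2 v, lew v w & r i v] `|` [set i0].
pose S w : set J := [set i | forall D, X w `<=` D -> closed D -> D i].
have Aclosed : closed A by move=> i j Ai Aj; have [] := (proj2 (ubP (i, j)) Ai Aj).
have XA w : X w `<=` A by move=> i [[]|->].
have SA w : S w `<=` A by move=> i Swi; exact: Swi (XA w) Aclosed.
have Sclosed w : closed (S w).
  by move=> i j Si Sj D XD Dcl; exact: Dcl (Si D XD Dcl) (Sj D XD Dcl).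
have XS w : X w `<=` S w by move=> i Xi D XD _; exact: XD.
have Sdir w : directed_set (S w).
  split=> [|i j Si Sj]; first by exists i0; apply: XS; right.
  have [_ ik jk] := (proj2 (ubP (i, j)) (SA _ _ Si) (SA _ _ Sj)).
  by exists (ub (i, j)); split=> //; exact: Sclosed.
have Scard w (K' : small) : [set: nat] #<= [set: K'] -> X w #<= [set: K'] ->
    S w #<= [set: K'].
  move=> Kinf XK.
  have [C XC [CK Ccl]] := card_closure (f := fun i j => ub (i, j)) Kinf XK
    (fun i => proj1 (ubP (i, i)) erefl).
  by apply: card_le_trans CK; apply: subset_card_le => i; apply.
have Xcard w : [set i | A i /\ exists2 v, lew v w & r i v] #<= [set v | lew v w].
  apply/card_le_relP; exists r; split=> [i [Ai [v vw riv]]|i j v [Ai _] [Aj _]].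
    by exists v.
  exact: ri.
have -> : A = \bigcup_w S w.
  apply/seteqP; split=> [i Ai|i [w _]]; last exact: SA.
  have [w _ riw] := rt i Ai; exists w => //; apply: XS; left; split=> //.
  by exists w => //; exact: well_order_refl.
have [w0 _ _] := rt i0 Ai0.
apply: (has_completion_chain (inhabits w0) wo) => [v w vw i Svi D XD Dcl|w].
  apply: Svi => // j [[Aj [x xv rjx]]|->]; apply: XD; [left|by right].
  by split=> //; exists x => //; exact: well_order_trans xv vw.
(* Over a finite segment the closure is only known to be countable, which the countable case
   handles; over an infinite one it is no larger than the segment, and [IH] applies. *)
have [sfin|/infiniteP sinf] := pselect (finite_set [set v | ~~ lew w v]).
  apply: has_completion_countable => //; apply: Scard => //.
  apply: finite_set_countable; rewrite /X finite_setU; split; last exact: finite_set1.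
  apply: card_le_finite (Xcard w) _.
  by rewrite (well_order_closed_seg wo) finite_setU.
apply: (IH w) => //; rewrite -(card_le_eqr (card_setT _)); apply: Scard.
  by rewrite (card_le_eqr (card_setT _)).
rewrite (card_le_eqr (card_setT _)) /X.
have XW : [set i | A i /\ exists2 v, lew v w & r i v] #<= [set v | ~~ lew w v].
  apply: card_le_trans (Xcard w) _; rewrite (well_order_closed_seg wo).
  exact: card_le_setU1.
(* Few points of [A] may be related to the segment, so the generators can be finite although the
   segment is infinite; [i0] is absorbed only in the infinite case. *)
have [Xfin|/infiniteP Xinf] :=
    pselect (finite_set [set i | A i /\ exists2 v, lew v w & r i v]).
  have XUfin : finite_set (X w) by rewrite /X finite_setU.
  by apply: card_le_trans sinf; exact: finite_set_countable.
by apply: card_le_trans XW; exact: card_le_setU1.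
Qed.

(** Well-founded induction on a bound for the size of [A], expressed as an initial segment of a
    well-order of [J]: the segments of a segment are again segments of [J]. *)
Lemma has_completion_directed (A : set J) : directed_set A -> has_completion A.
Proof.
have [leJ wo] := wo J.
apply: (has_completion_wo wo) => [|a]; first exact: card_leT.
elim: (well_order_wf wo a) => {A}a _ IH A Adir Aa.
apply: (has_completion_wo (W := set_type [set b | ~~ leJ a b])
  (well_order_sub wo (f := val) val_inj)) => // [|w B Bdir Bw].
  by rewrite (card_le_eqr (card_setT _)).
apply: (IH (val w) _ B) => //; first exact: set_valP w.
by apply: card_le_trans Bw _; apply: (card_le_fun (f := val)) => // x y _ _ /val_inj.
Qed.

End Completion.

(** * Colimits and presentable objects *)

(** Proof irrelevance replaces decidable equality of the index type. *)
Lemma existT_inj (I : Type) (P : I -> Type) i (x y : P i) :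
  existT P i x = existT P i y -> x = y.
Proof.
by move=> e; have := projT2_eq e; rewrite (Prop_irrelevance (projT1_eq e) erefl).
Qed.

Lemma nat_lt_uncountable (k : small) : uncountable k -> [set: nat] #< [set: k].
Proof. exact: card_ltNge. Qed.

Lemma card_directed_le (k l I : small) (le : rel I) :
  [set: k] #<= [set: l] -> card_directed l le -> card_directed k le.
Proof.
move=> kl [po dir]; split=> // A Ak; apply: dir; exact: card_lt_le_trans kl.
Qed.

Lemma presentable_le (k l : small) (C : category) (M : C) :
  [set: k] #<= [set: l] -> presentable k M -> presentable l M.
Proof. by move=> kl Mk I le /(card_directed_le kl) dir D X c; exact: Mk. Qed.

(* Compare the two maps Hom(M, X) -> bool that are constantly true on the image
   of the legs. *)
Lemma presentable_factor (k : small) (C : category) (M : C) (I : small) (le : rel I)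
    (D : diagram C le) (X : C) (c : cocone D X) (f : hom M X) :
  presentable k M -> card_directed k le -> is_colimit c ->
  exists i (g : hom M (D i)), comp (leg c i) g = f.
Proof.
move=> Mk dir ccol.
pose T i : hom (hom_diagram M D i) (bool : SET) := fun=> true.
have TM i j (h : le i j) : comp (T j) (dmap (hom_diagram M D) h) = T i by [].
have [b [_ bU]] := Mk I le dir D X c ccol bool (Cocone TM).
have b1 : b = fun=> true by apply: bU.
have b2 : b = fun f' => `[< exists i (g : hom M (D i)), comp (leg c i) g = f' >].
  by apply: bU => i; apply/funext => g; apply/asboolP; exists i, g.
by apply/asboolP; have := congr1 (@^~ f) b2; rewrite b1.
Qed.

(** * Dense sets and density characters of structures *)

Section Density.
Variables (R : realType) (L : language).
Implicit Types M N : structure R L.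

Lemma sum_density_min M (A : forall s, set (car M s)) k (D : set {s & car M s}) :
  sum_density A k -> (forall s x, D (existT _ s x) -> A s x) ->
  (forall s x, A s x -> closure [set y | D (existT _ s y)] x) -> [set: k] #<= D.
Proof.
move=> [d dA kd] DA AD; rewrite (card_le_eql kd).
have /all_sig[f fP] s : {f : d s -> car M s |
    (forall t, D (existT _ s (f t))) /\ injective f}.
  apply: cid; have := proj2 (dA s) [set y | D (existT _ s y)] (DA s) (AD s).
  move=> /card_le_relP[r [rt ri]].
  have /choice[f fP] t : exists y, D (existT _ s y) /\ r t y.
    by have [y] := rt t I; exists y.
  exists f; split=> [t|t t' ft]; first exact: (proj1 (fP t)).
  by apply: (ri _ _ (f t)) => //; [exact: (proj2 (fP t))|rewrite ft; exact: (proj2 (fP t'))].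
apply: (card_le_fun (f := fun t : {s & d s} => existT (car M) (tag t) (f _ (tagged t)))).
  by move=> [s t] _; exact: (proj1 (fP s) t).
move=> [s t] [s' t'] _ _ /= e; have /= ss := congr1 tag e.
by subst s'; rewrite (proj2 (fP s) _ _ (existT_inj e)).
Qed.

Lemma sum_density_dense M (A : forall s, set (car M s)) k :
  sum_density A k -> exists2 D : set {s & car M s},
    (forall s x, A s x -> closure [set y | D (existT _ s y)] x) & D #<= [set: k].
Proof.
move=> [d dA kd].
have /all_sig[E EP] s : {E : set (car M s) | A s `<=` closure E /\ E #<= [set: d s]}.
  by apply: cid; have [[E [_ AE /card_eqPle[Ed _]]] _] := dA s; exists E.
exists [set z | E (tag z) (tagged z)] => [s x|]; first exact: (proj1 (EP s)).
rewrite (card_le_eqr kd).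
have /all_sig[r rP] s : {r : car M s -> d s -> Prop |
    (forall x, E s x -> exists t, r x t) /\
    forall x x' t, E s x -> E s x' -> r x t -> r x' t -> x = x'}.
  apply: cid; have /card_le_relP[r [rt ri]] := proj2 (EP s).
  by exists r; split=> // x /rt[t]; exists t.
apply/card_le_relP; exists (fun z t => exists s x y,
  [/\ z = existT (car M) s x, t = existT d s y & r s x y]); split.
  move=> [s x] /= Ex; have [t rt] := proj1 (rP s) x Ex.
  by exists (existT d s t) => //; exists s, x, t.
move=> z z' w Ez Ez' [s [x [t [zE wE rt]]]] [s' [x' [t' [z'E w'E rt']]]].
subst z z' w; have /= ss := congr1 tag w'E; subst s'.
have tt := existT_inj w'E; subst t'.
by rewrite (proj2 (rP s) x x' t).
Qed.

(** Expresses that the density character is below [lam] by a witness: a single set of sorted points,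
    dense in every sort including the reals. *)
Definition small_dc (lam : small) M : Prop :=
  exists2 D : set {s & car M s},
    (forall s x, closure [set y | D (existT _ s y)] x) & D #< [set: lam].

Lemma dc_is_small (lam k : small) M :
  dc_is M k -> [set: k] #< [set: lam] -> small_dc lam M.
Proof.
move=> /sum_density_dense[D Ddense Dk] klam.
by exists D => [s x|]; [exact: Ddense|exact: card_le_lt_trans Dk klam].
Qed.

Lemma small_dc_lt (lam k : small) M :
  small_dc lam M -> dc_is M k -> [set: k] #< [set: lam].
Proof.
move=> [D Ddense Dlam] Mk; apply: card_le_lt_trans Dlam.
by apply: sum_density_min Mk _ _.
Qed.

Lemma emb_closure M N (f : embedding M N) s (A : set (car M s)) x :
  closure A x -> closure (f s @` A) (f s x).
Proof.
move/closure_mdistP => Ax; apply/closure_mdistP => e /Ax[y Ay xy].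
by exists (f s y); [exists y|rewrite emb_mdist].
Qed.

Lemma small_dc_surj (lam : small) M N (f : embedding M N) :
  (forall s y, range (f s) y) -> small_dc lam M -> small_dc lam N.
Proof.
move=> fs [D Ddense Dlam].
pose F (z : {s & car M s}) : {s & car N s} := existT _ (tag z) (f _ (tagged z)).
exists (F @` D) => [s y|]; last exact: card_le_lt_trans (card_image_le _ _) Dlam.
have [x _ <-] := fs s y; have := emb_closure (f := f) (Ddense s x).
by apply: closure_subset => _ [x' Dx' <-]; exists (existT _ s x').
Qed.

Variable K : mAEC R L.

(** [D] is dense in its own closure, so the density character [a] of that closure is at most the
    size of [D], and the sum of [a] and [LS K] stays below [lam]. *)
Lemma small_LS (lam : small) M (D : set {s & car M s}) :
  uncountable lam -> regular lam -> [set: LS K] #< [set: lam] -> D #< [set: lam] ->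
  inK K M -> exists N (f : embedding N M),
    [/\ leK K f, small_dc lam N & forall s y, D (existT _ s y) -> range (f s) y].
Proof.
move=> lunc lreg LSlam Dlam MK.
have [N [f [fK Df [n [a [Nn Da na]]]]]] := leK_LS (fun s => [set y | D (existT _ s y)]) MK.
exists N, f; split=> //.
apply: dc_is_small Nn _; apply: card_le_lt_trans na _; apply: card_lt_sum => //.
apply: card_le_lt_trans Dlam; apply: sum_density_min Da _ _ => // s x Dx.
exact: subset_closure.
Qed.

End Density.

Section Category.
Variables (R : realType) (L : language) (K : mAEC R L).
Let C := mAEC_category K.

Definition hom_emb (X Y : C) (f : hom X Y) : embedding (sval X) (sval Y) := sval f.

Lemma hom_embK (X Y : C) (f : hom X Y) : leK K (hom_emb f).
Proof. exact: svalP. Qed.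

Lemma hom_emb_inj (X Y : C) (f g : hom X Y) : hom_emb f = hom_emb g -> f = g.
Proof.
case: f g => [f hf] [g hg]; rewrite /hom_emb /= => fg; subst g.
by rewrite (Prop_irrelevance hf hg).
Qed.

Lemma hom_emb_comp (X Y Z : C) (g : hom Y Z) (f : hom X Y) :
  hom_emb (comp g f) = comp_emb (hom_emb g) (hom_emb f).
Proof. by []. Qed.

Lemma hom_mono (X Y Z : C) (g : hom Y Z) (f f' : hom X Y) :
  comp g f = comp g f' -> f = f'.
Proof.
by move=> e; apply/hom_emb_inj/(@comp_emb_inj _ _ _ _ _ (hom_emb g)); rewrite -!hom_emb_comp e.
Qed.

Lemma hom_factor (X Y Z : C) (f : hom X Z) (g : hom Y Z) :
  (forall s, range (hom_emb f s) `<=` range (hom_emb g s)) ->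
  exists h : hom X Y, comp g h = f.
Proof.
move=> fg; have [h hP hK] := leK_factor (hom_embK f) (hom_embK g) fg.
by exists (exist _ h hK : hom X Y); exact: hom_emb_inj.
Qed.

(** The identity of [Y] factors through [g]; the other equation follows because [g] is a
    monomorphism. *)
Lemma hom_inverse (X Y : C) (g : hom X Y) :
  (forall s y, range (hom_emb g s) y) ->
  exists2 h : hom Y X, comp g h = idm Y & comp h g = idm X.
Proof.
move=> gs; have [|h hP] := @hom_factor Y X Y (idm Y) g; first by move=> s x _.
by exists h => //; apply: (@hom_mono _ _ _ g); rewrite compA hP comp1m compm1.
Qed.

(** * Colimits as cocones with dense union of ranges *)

Section Diagram.
Variables (I : small) (le : rel I) (D : diagram C le).
Hypothesis dir : card_directed nat le.

Definition dense_cocone (X : C) (c : cocone D X) : Prop :=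
  forall s (x : car (sval X) s) (e : R), 0 < e ->
    exists i y, mdist x (hom_emb (leg c i) s y) < e.

Lemma dense_colimit_exists :
  exists (X : C) (c : cocone D X), is_colimit c /\ dense_cocone c.
Proof.
have [[[le_refl le_trans] _] ub] := dir.
have fin_ub (A : set I) : finite_set A -> exists j, forall i, A i -> le i j.
  by move=> Afin; apply: ub; apply: card_ltNge; exact/finite_setPn.
have Idir : directed_set le setT.
  split=> [|i j _ _]; first by have [j _] := fin_ub _ (@finite_set0 I); exists j.
  have [k kub] := fin_ub _ (finite_set2 i j).
  by exists k; split=> //; apply: kub; [left|right].
pose m i j (h : le i j) := hom_emb (dmap D h).
have m1 i (h : le i i) : m i i h = id_emb (sval (D i)) by rewrite /m dmap1.
have mM i j k (hij : le i j) (hjk : le j k) (hik : le i k) :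
    comp_emb (m j k hjk) (m i j hij) = m i k hik.
  by rewrite /m -hom_emb_comp (dmapM D _ _ hik).
have mK i j (h : le i j) : leK K (m i j h) by exact: hom_embK.
have [U [u [um udense uK uuniv]]] := has_completion_directed le_refl le_trans m1 mM mK Idir.
have [[i0 _] _] := Idir.
pose X : C := exist _ U (proj2 (leK_inK (uK i0 Logic.I))).
pose ui i : hom (D i) X := exist _ (u i Logic.I) (uK i Logic.I).
have uiM i j (h : le i j) : comp (ui j) (dmap D h) = ui i.
  exact/hom_emb_inj/um.
exists X, (Cocone uiM); split=> [Y c'|s x e e0]; last first.
  by have [i [[] [y xy]]] := udense s x e e0; exists i, y.
have [i j _ _ h|i _|g gu gK] := uuniv (sval Y) (fun i _ => hom_emb (leg c' i)).
- by rewrite /m -hom_emb_comp legM.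
- exact: hom_embK.
exists (exist _ g gK); split=> [i|g' g'u]; first exact/hom_emb_inj/gu.
apply: hom_emb_inj; apply: (emb_eq_dense udense) => i [].
by rewrite gu -(g'u i).
Qed.

(** Density holds for the colimit built from the completion and is carried to [X] by the comparison
    map [g], an isometry with right inverse [h]. *)
Lemma colimit_dense (X : C) (c : cocone D X) : is_colimit c -> dense_cocone c.
Proof.
move=> ccol; have [U [u [ucol udense]]] := dense_colimit_exists.
have [g [gu _]] := ucol X c; have [h [hc _]] := ccol U u.
have gh : comp g h = idm X.
  have [f [_ fU]] := ccol X c.
  have <- : f = comp g h by apply: fU => i; rewrite -compA hc gu.
  by apply: fU => i; rewrite comp1m.
move=> s x e e0; have [i [y xy]] := udense s (hom_emb h s x) e e0.
exists i, y; rewrite -gu hom_emb_comp comp_embE -(emb_mdist (hom_emb g)) in xy *.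
by move: xy; rewrite -comp_embE -hom_emb_comp gh id_embE.
Qed.

(** The comparison map from the constructed colimit to [X] has dense and closed range, so it is
    invertible and transports the universal property. *)
Lemma dense_colimit (X : C) (c : cocone D X) : dense_cocone c -> is_colimit c.
Proof.
move=> cdense; have [U [u [ucol udense]]] := dense_colimit_exists.
have [g [gu _]] := ucol X c.
have [|h gh hg] := @hom_inverse _ _ g.
  move=> s x; apply: emb_range_closed; apply/closure_mdistP => e e0.
  have [i [y xy]] := cdense s x e e0.
  exists (hom_emb (leg c i) s y) => //; exists (hom_emb (leg u i) s y) => //.
  by rewrite -comp_embE -hom_emb_comp gu.
move=> Y c'; have [f [fu fU]] := ucol Y c'.
exists (comp f h); split=> [i|f' f'c].
  by rewrite -gu -compA [comp h _]compA hg comp1m fu.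
rewrite (fU (comp f' g)) => [|i]; last by rewrite -compA gu f'c.
by rewrite -compA gh compm1.
Qed.

End Diagram.

(** * Factoring through the legs of a colimit *)

Section Presentable.
Variables (lam : small) (I : small) (le : rel I) (D : diagram C le).
Hypothesis lunc : uncountable lam.
Hypothesis dir : card_directed lam le.
Variables (X : C) (c : cocone D X).
Hypothesis ccol : is_colimit c.

Lemma leg_range_mono i j s :
  le i j -> range (hom_emb (leg c i) s) `<=` range (hom_emb (leg c j) s).
Proof.
move=> ij _ [x _ <-]; rewrite -(legM c ij) hom_emb_comp comp_embE.
by exists (hom_emb (dmap D ij) s x).
Qed.

Lemma leg_jointly_surjective s (x : car (sval X) s) :
  exists i, range (hom_emb (leg c i) s) x.
Proof.
have natlam := nat_lt_uncountable lunc.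
have dense := colimit_dense (card_directed_le (proj1 natlam) dir) ccol.
(* Leg [i n] comes within [1/(n+1)] of [x]; a common upper bound [j] of these countably many indices
   has [x] in the closure of its range. *)
have /choice[i iP] n := dense s x n.+1%:R^-1 ltac:(by rewrite invr_gt0).
have [|j jub] := proj2 dir (range i).
  exact: card_le_lt_trans (card_image_le _ _) natlam.
exists j; apply: emb_range_closed; apply/closure_mdistP => e e0.
pose n := Num.Def.archi_bound e^-1.
have [y xy] := iP n.
exists (hom_emb (leg c (i n)) s y).
  by apply: (@leg_range_mono (i n)); [apply: jub; exists n|exists y].
apply: lt_trans xy _.
rewrite invf_plt ?posrE //.
apply: lt_trans (archi_boundP _) _; first by rewrite invr_ge0 ltW.
by rewrite ltr_nat.
Qed.

Lemma leg_range_bound (P : set {s & car (sval X) s}) : P #< [set: lam] ->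
  exists i, forall s x, P (existT _ s x) -> range (hom_emb (leg c i) s) x.
Proof.
move=> Plam.
have /choice[i iP] (z : {s & car (sval X) s}) : exists i,
    range (hom_emb (leg c i) (tag z)) (tagged z).
  exact: leg_jointly_surjective.
have [|j jub] := proj2 dir (i @` P); first exact: card_le_lt_trans (card_image_le _ _) Plam.
exists j => s x Px; apply: (@leg_range_mono (i (existT _ s x))).
  by apply: jub; exists (existT _ s x).
exact: (iP (existT _ s x)).
Qed.

(** One leg catches the image of a dense set, hence the image of all of [M], because its range is
    closed. *)
Lemma small_factor (M : C) (f : hom M X) : small_dc lam (sval M) ->
  exists i (g : hom M (D i)), comp (leg c i) g = f.
Proof.
move=> [E Edense Elam].
pose F (z : {s & car (sval M) s}) : {s & car (sval X) s} :=
  existT _ (tag z) (hom_emb f _ (tagged z)).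
have [|i iP] := @leg_range_bound (F @` E).
  exact: card_le_lt_trans (card_image_le _ _) Elam.
exists i; apply: hom_factor => s _ [x _ <-]; apply: emb_range_closed.
have := emb_closure (f := hom_emb f) (Edense s x); apply: closure_subset => _ [y Ey <-].
by apply: iP; exists (existT _ s y).
Qed.

End Presentable.

Lemma small_presentable (lam : small) (M : C) :
  uncountable lam -> small_dc lam (sval M) -> presentable lam M.
Proof.
move=> lunc Mlam I le dir D X c ccol Y c'.
have fac (f : hom M X) : {ig : {i & hom M (D i)} | comp (leg c (tag ig)) (tagged ig) = f}.
  apply: cid; have [i [g ig]] := small_factor lunc dir ccol f Mlam.
  by exists (existT _ i g).
(* The value does not depend on the factorization: over a common bound [k], two factorizations of
   one map coincide because [leg c k] is a monomorphism. *)
have c'E i j (g : hom M (D i)) (g' : hom M (D j)) :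
    comp (leg c i) g = comp (leg c j) g' -> leg c' i g = leg c' j g'.
  move=> gg'; have [|k kub] := proj2 dir [set i; j].
    apply: card_le_lt_trans (nat_lt_uncountable lunc); exact: finite_set_countable.
  have ik : le i k by apply: kub; left.
  have jk : le j k by apply: kub; right.
  have E l (lk : le l k) (h : hom M (D l)) : leg c' l h = leg c' k (comp (dmap D lk) h).
    by rewrite -(legM c' lk).
  rewrite (E i ik) (E j jk); congr (leg c' k _); apply: (@hom_mono _ _ _ (leg c k)).
  by rewrite !compA !legM.
exists (fun f => leg c' _ (tagged (sval (fac f)))); split=> [i|h hP].
  by apply/funext => g; apply: c'E; exact: (svalP (fac (comp (leg c i) g))).
by apply/funext => f; case: (fac f) => -[i g] /= <-; rewrite -(hP i).
Qed.

End Category.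

(** * Accessibility and presentability rank *)

Lemma mdist_separated (R : realType) (X : metricType R) (x x' : X) :
  (forall n : nat, exists2 y, mdist x y < n.+1%:R^-1 & mdist x' y < n.+1%:R^-1) -> x = x'.
Proof.
move=> near; apply: mdist_positivity; apply/eqP; rewrite eq_le mdist_ge0 andbT.
apply/ler_addgt0Pl => e e0; rewrite addr0.
have [y xy x'y] := near (Num.Def.archi_bound (e / 2)^-1).
have near_e : (Num.Def.archi_bound (e / 2)^-1).+1%:R^-1 < e / 2 :> R.
  rewrite invf_plt ?posrE ?divr_gt0 //; apply: lt_trans (archi_boundP _) _.
    by rewrite invr_ge0 ltW // divr_gt0.
  by rewrite ltr_nat.
apply: le_trans (metric_triangle _ y _) _.
by rewrite [e]splitr [mdist y _]metric_sym lerD ?ltW // (lt_trans _ near_e).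
Qed.

(** * Codes for structures up to isomorphism *)

Section Code.
Variables (R : realType) (L : language) (W : small).
Implicit Types M N : structure R L.

(** The real sort is the same in all structures, so it codes itself. *)
Definition code_sort (s : option (Lsort L)) : small := if s is Some _ then W else R.

(* The structure transported along injections of its sorts into [W]: up to
   isomorphism it is determined by this element of a small type. *)
Record code := Code {
  code_dist : Lsort L -> W -> W -> R -> Prop;
  code_const : forall c : Lconst L, code_sort (const_sort c) -> Prop;
  code_fun : forall f : Lfun L, (forall i, code_sort (fun_dom f i)) ->
    code_sort (fun_cod f) -> Prop;
  code_rel : forall r : Lrel L, (forall i, code_sort (rel_dom r i)) -> R -> Prop
}.

Definition code_map M (e : forall s, str_sort M s -> W) s : car M s -> code_sort s :=
  match s with Some s' => e s' | None => id end.

Lemma code_map_inj M (e : forall s, str_sort M s -> W) s :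
  (forall s, injective (e s)) -> injective (@code_map M e s).
Proof. by move=> ei; case: s => [s|//]; exact: ei. Qed.

Definition structure_code M (e : forall s, str_sort M s -> W) : code := Code
  (fun s w w' r => exists x y : str_sort M s, [/\ w = e s x, w' = e s y & r = mdist x y])
  (fun c w => w = code_map e (str_const M c))
  (fun f ws w => exists a : forall i, car M (fun_dom f i),
     (forall i, ws i = code_map e (a i)) /\ w = code_map e (str_fun a))
  (fun r ws v => exists a : forall i, car M (rel_dom r i),
     (forall i, ws i = code_map e (a i)) /\ v = str_rel a).

(** The range of [e s] is visible in the code, as the points that occur in the distance relation.
    Equal codes thus match the points of [M] and [N], and the remaining graphs show that this
    matching preserves the structure. *)
Lemma code_iso M N (e : forall s, str_sort M s -> W) (e' : forall s, str_sort N s -> W) :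
  (forall s, injective (e s)) -> (forall s, injective (e' s)) ->
  structure_code e = structure_code e' ->
  exists f : embedding M N, is_iso f.
Proof.
move=> ei e'i ee'.
have eE := @code_map_inj M e ^~ ei; have e'E := @code_map_inj N e' ^~ e'i.
have distE s := congr1 (fun c => code_dist c s) ee'.
have constE c := congr1 (fun k => @code_const k c) ee'.
have funE f := congr1 (fun k => @code_fun k f) ee'.
have relE r := congr1 (fun k => @code_rel k r) ee'.
have /all_sig[h hP] s : {h : str_sort M s -> str_sort N s | forall x, e' s (h x) = e s x}.
  have /choice[h hP] x : exists y, e' s y = e s x.
    have : code_dist (structure_code e) s (e s x) (e s x) (mdist x x) by exists x, x.
    by rewrite ee' => -[y [_ [-> _ _]]]; exists y.
  by exists h.
have /all_sig[k kP] s : {k : str_sort N s -> str_sort M s | forall y, h s (k y) = y}.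
  have /choice[k kP] y : exists x, h s x = y.
    have : code_dist (structure_code e') s (e' s y) (e' s y) (mdist y y) by exists y, y.
    by rewrite -ee' => -[x [_ [yx _ _]]]; exists x; apply: (e'i s); rewrite hP yx.
  by exists k.
pose H := @map_interp _ _ M N h.
have HE s (x : car M s) : code_map e' (H s x) = code_map e x.
  by case: s x => //= s x; exact: hP.
have Hsurj s (y : car N s) : {x | H s x = y}.
  by case: s y => [s|] y; [exists (k s y); exact: kP|exists y].
have hdist s x y : mdist (h s x) (h s y) = mdist x y.
  have : code_dist (structure_code e) s (e s x) (e s y) (mdist x y) by exists x, y.
  rewrite ee' => -[x' [y' [xx' yy' ->]]].
  by rewrite (e'i s (h s x) x') ?hP // (e'i s (h s y) y') ?hP.
have Hdist s (x y : car M s) : mdist (H s x) (H s y) = mdist x y.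
  by case: s x y => [s|] x y //; exact: hdist.
have hconst c : H _ (str_const M c) = str_const N c.
  have : code_const (structure_code e) (code_map e (str_const M c)) by [].
  by rewrite ee' => cE; apply: e'E; rewrite HE.
have tupE n (d : 'I_n -> option (Lsort L)) (a : forall i, car M (d i))
    (a' : forall i, car N (d i)) :
    (forall i, code_map e (a i) = code_map e' (a' i)) -> a' = fun i => H _ (a i).
  move=> aa'; apply: functional_extensionality_dep => i.
  by apply: e'E; rewrite HE aa'.
have hfun f (a : forall i, car M (fun_dom f i)) :
    H _ (str_fun a) = str_fun (fun i => H _ (a i) : car N (fun_dom f i)).
  have : code_fun (structure_code e) (fun i => code_map e (a i)) (code_map e (str_fun a)).
    by exists a.
  by rewrite ee' => -[a' [/tupE -> faE]]; apply: e'E; rewrite HE.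
have hrelE r (a : forall i, car M (rel_dom r i)) :
    str_rel (fun i => H _ (a i) : car N (rel_dom r i)) = str_rel a.
  have : code_rel (structure_code e) (fun i => code_map e (a i)) (str_rel a).
    by exists a.
  by rewrite ee' => -[a' [/tupE -> ->]].
have hrel r (a : forall i, car M (rel_dom r i)) (v : R) : 0 <= v <= 1 ->
    dist_to a (@str_rel _ _ M r @^-1` [set v]) =
    dist_to (fun i => H _ (a i) : car N (rel_dom r i)) (@str_rel _ _ N r @^-1` [set v]).
  (* The bijection preserves the values of relations, so it carries each level set onto the
     corresponding one without changing distances. *)
  move=> _; congr ereal_inf.
  have maxE (b : forall i, car M (rel_dom r i)) :
      max_dist (fun i => H _ (a i) : car N (rel_dom r i)) (fun i => H _ (b i)) = max_dist a b.
    by apply: eq_bigr => i _; exact: Hdist.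
  apply/seteqP; split=> _ [b /= bv <-].
    by exists (fun i => H _ (b i)); rewrite ?maxE //= hrelE.
  have bE : b = fun i => H _ (sval (Hsurj _ (b i))).
    by apply: functional_extensionality_dep => i; case: (Hsurj _ (b i)).
  exists (fun i => sval (Hsurj _ (b i))); first by rewrite /= -hrelE -bE.
  by rewrite -maxE -bE.
exists (Embedding hconst hdist hfun hrel) => s.
exists (fun y => sval (Hsurj s y)) => [x|y]; last by case: (Hsurj s y).
case: (Hsurj _ _) => x' /= x'E; apply: eE; rewrite -!HE x'E //.
Qed.

End Code.

(** A point is determined by a sequence of approximations from the dense set, the [n]-th one within
    [1/(n+1)], and each approximation is named by an element of [lam]. *)
Lemma small_dc_inj (R : realType) (L : language) (lam : small) (M : structure R L) :
  small_dc lam M ->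
  exists e : forall s, str_sort M s -> (nat -> lam), forall s, injective (e s).
Proof.
move=> [D Ddense [/card_le_relP[r [rt ri]] _]].
have /all_sig[e eP] s : {e : str_sort M s -> nat -> lam | forall x n, exists y,
    [/\ mdist x y < n.+1%:R^-1, D (existT (car M) (Some s) y) &
        r (existT (car M) (Some s) y) (e x n)]}.
  have /choice[e eP] (xn : str_sort M s * nat) : exists t, exists y,
      [/\ mdist xn.1 y < xn.2.+1%:R^-1, D (existT (car M) (Some s) y) &
          r (existT (car M) (Some s) y) t].
    have /closure_mdistP near := Ddense (Some s) xn.1.
    have [|y Dy xy] := near xn.2.+1%:R^-1; first by rewrite invr_gt0.
    by have [t _ ryt] := rt _ Dy; exists t, y.
  by exists (fun x n => e (x, n)) => x n; exact: eP (x, n).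
exists e => s x x' ee; apply: mdist_separated => n.
have [[y [xy Dy ry]] [y' [x'y' Dy' ry']]] := (eP s x n, eP s x' n).
exists y => //; rewrite ee in ry.
by rewrite (existT_inj (ri _ _ _ Dy Dy' ry ry')).
Qed.

Section Accessible.
Variables (R : realType) (L : language) (K : mAEC R L).
Let C := mAEC_category K.

(** Codes over [nat -> lam] form a small type; one structure is chosen for each code that occurs. *)
Lemma small_representatives (lam : small) :
  exists (A : small) (G : A -> C), (forall a, small_dc lam (sval (G a))) /\
    forall M : C, small_dc lam (sval M) -> exists a (f : hom (G a) M),
      forall s y, range (hom_emb f s) y.
Proof.
pose coded (M : C) (c : code R L (nat -> lam)) := small_dc lam (sval M) /\
  exists2 e : forall s, str_sort (sval M) s -> (nat -> lam),
    (forall s, injective (e s)) & structure_code e = c.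
pose A := {c | exists M, coded M c}; pose G (a : A) := sval (cid (svalP a)).
have GP a : coded (G a) (sval a) by exact: svalP (cid (svalP a)).
exists A, G; split=> [a|M Mlam]; first exact: (proj1 (GP a)).
have [e ei] := small_dc_inj Mlam.
have Mc : coded M (structure_code e) by split=> //; exists e.
pose a : A := exist _ (structure_code e) (ex_intro _ M Mc).
have [_ [e' e'i e'E]] := GP a; have [f fi] := code_iso e'i ei e'E.
exists a, (exist _ f (leK_iso_emb (svalP (G a)) fi)) => s y.
by have [g _ gK] := fi s; exists (g y).
Qed.

Lemma small_accessible (lam : small) :
  uncountable lam -> regular lam -> [set: LS K] #< [set: lam] ->
  exists (A : small) (G : A -> C), (forall a, small_dc lam (sval (G a))) /\
    forall X : C, exists (I : small) (le : rel I) (D : diagram C le) (c : cocone D X),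
      [/\ card_directed lam le, is_colimit c & forall i, exists a, D i = G a].
Proof.
move=> lunc lreg LSlam; have [A [G [Gsmall Grep]]] := small_representatives lam.
exists A, G; split=> // X.
(* The indices are the ranges rather than the embeddings, so that inclusion is antisymmetric; a
   representative and an embedding with the given range are then chosen. *)
pose I := {B : forall s, set (car (sval X) s) |
  exists a (f : hom (G a) X), forall s, B s = range (hom_emb f s)}.
pose le : rel I := fun i j => `[< forall s, sval i s `<=` sval j s >].
pose a (i : I) : A := sval (cid (svalP i)).
pose f (i : I) : hom (G (a i)) X := sval (cid (svalP (cid (svalP i)))).
have fP i s : sval i s = range (hom_emb (f i) s).
  exact: (svalP (cid (svalP (cid (svalP i))))).
have d_ex i j (h : le i j) : {d : hom (G (a i)) (G (a j)) | comp (f j) d = f i}.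
  by apply: cid; apply: hom_factor => s; rewrite -!fP; exact: (asboolP _ h).
pose d i j h := sval (d_ex i j h).
have dE i j h : comp (f j) (d i j h) = f i by exact: svalP (d_ex i j h).
have d1 i (h : le i i) : d i i h = idm (G (a i)).
  by apply: (@hom_mono _ _ _ _ _ _ (f i)); rewrite dE compm1.
have dM i j k (hij : le i j) (hjk : le j k) (hik : le i k) :
    comp (d j k hjk) (d i j hij) = d i k hik.
  by apply: (@hom_mono _ _ _ _ _ _ (f k)); rewrite compA !dE.
pose D : diagram C le := Diagram d1 dM.
pose c : cocone D X := Cocone (D := D) dE.
(* Both directedness and density of the cocone come from this covering property. *)
have cover (P : set {s & car (sval X) s}) : P #< [set: lam] ->
    exists i : I, forall s y, P (existT _ s y) -> sval i s y.
  move=> Plam.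
  have [N [g [gK Nsmall Pg]]] := small_LS lunc lreg LSlam Plam (svalP X).
  pose N' : C := exist _ N (proj1 (leK_inK gK)).
  pose g' : hom N' X := exist _ g gK.
  have [b [u usurj]] := Grep N' Nsmall.
  pose B s : set (car (sval X) s) := range (hom_emb (comp g' u) s).
  have BP : exists a (f : hom (G a) X), forall s, B s = range (hom_emb f s).
    by exists b, (comp g' u).
  exists (exist _ B BP) => s y /Pg[z _ <-] /=; have [w _ <-] := usurj s z.
  by exists w => //; rewrite hom_emb_comp comp_embE.
have dir : card_directed lam le.
  split.
    split; first split.
    - by move=> i; apply/asboolP => s x.
    - by move=> j i k /asboolP ij /asboolP jk; apply/asboolP => s x /ij/jk.
    move=> [B hB] [B' hB'] /andP[/asboolP /= BB' /asboolP /= B'B].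
    apply: eq_exist; apply: functional_extensionality_dep => s.
    by apply/seteqP; split.
  (* By regularity, dense sets of all members of [S] have together fewer than [lam] points. A
     substructure covering them contains every member of [S], as it is closed. *)
  move=> S Slam.
  have /all_sig[E EP] i : {E : set {s & car (sval (G (a i))) s} |
      (forall s x, closure [set y | E (existT _ s y)] x) /\ E #< [set: lam]}.
    by apply: cid; have [E ? ?] := Gsmall (a i); exists E.
  pose F (z : {i : set_type S & set_type (E (val i))}) : {s & car (sval X) s} :=
    existT _ (tag (val (tagged z)))
      (hom_emb (f (val (tag z))) _ (tagged (val (tagged z)))).
  have [|j jP] := cover (range F).
    apply: card_le_lt_trans (card_image_le _ _) _; apply: (proj2 lreg).
      by apply: card_le_lt_trans Slam; have /card_eqPle[] := card_setT S.
    move=> i; apply: card_le_lt_trans (proj2 (EP (val i))).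
    by have /card_eqPle[] := card_setT (E (val i)).
  exists j => i Si; apply/asboolP => s; rewrite !fP => _ [x _ <-].
  apply: emb_range_closed; rewrite -fP.
  have := emb_closure (f := hom_emb (f i)) (proj1 (EP i) s x).
  apply: closure_subset => _ [y Ey <-]; apply: jP.
  have Ey' : existT _ s y \in E i by exact: mem_set.
  by exists (existT (fun i : set_type S => set_type (E (val i)))
    (SigSub (mem_set Si)) (SigSub Ey')).
have natlam := nat_lt_uncountable lunc.
exists I, le, D, c; split=> //; last by move=> i; exists (a i).
apply: dense_colimit; first exact: card_directed_le (proj1 natlam) dir.
move=> s x e e0; have [|i iP] := cover [set existT _ s x].
  by apply: card_le_lt_trans natlam; apply: finite_set_countable; exact: finite_set1.
have := iP s x erefl; rewrite fP => -[y _ yx].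
by exists i, y; rewrite yx mdistxx.
Qed.

Lemma accessible_mAEC (lam : small) :
  uncountable lam -> regular lam -> [set: LS K] #< [set: lam] -> accessible lam C.
Proof.
move=> lunc lreg LSlam; split.
  move=> I le /(card_directed_le (proj1 (nat_lt_uncountable lunc))) dir D.
  by have [X [c [ccol _]]] := dense_colimit_exists D dir; exists X, c.
have [A [G [Gsmall Gcol]]] := small_accessible lunc lreg LSlam.
by exists A, G; split=> // a; exact: small_presentable.
Qed.

(** The identity of [M] factors through a leg from a small representative, so that leg is onto. *)
Lemma presentable_small (lam : small) (M : C) :
  uncountable lam -> regular lam -> [set: LS K] #< [set: lam] ->
  presentable lam M -> small_dc lam (sval M).
Proof.
move=> lunc lreg LSlam Mpres; have [A [G [Gsmall Gcol]]] := small_accessible lunc lreg LSlam.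
have [I [le [D [c [dir ccol DG]]]]] := Gcol M.
have [i [g cg]] := presentable_factor (idm M) Mpres dir ccol.
have Dsmall : small_dc lam (sval (D i)) by have [a ->] := DG i.
apply: (small_dc_surj (f := hom_emb (leg c i)) _ Dsmall) => s y.
by exists (hom_emb g s y) => //; rewrite -comp_embE -hom_emb_comp cg id_embE.
Qed.

(* The Loewenheim-Skolem axiom for [A] the whole of [M] asserts in passing that
   the density characters exist. *)
Lemma dc_exists (M : C) : exists k, dc_is (sval M) k.
Proof.
have [N [f [_ _ [_ [a [_ [d dT aE] _]]]]]] := leK_LS (fun=> setT) (svalP M).
by exists a, d => // s; have := dT s; rewrite closureT.
Qed.

Lemma uncountable_gt (k l : small) : infinite k -> [set: k] #< [set: l] -> uncountable l.
Proof. by move=> kinf [_ nlk] /card_le_trans/(_ kinf). Qed.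

Lemma presentability_rank_dc (lam lam_plus : small) (M : C) :
  uncountable lam -> [set: LS K] #< [set: lam] -> is_successor lam lam_plus ->
  presentability_rank M lam_plus <-> dc_is (sval M) lam.
Proof.
move=> lunc LSlam lsucc.
have linf : infinite lam by exact: (proj1 (nat_lt_uncountable lunc)).
have [ll _] := lsucc.
have lpunc : uncountable lam_plus by exact: uncountable_gt ll.
have lpreg : regular lam_plus by exact: regular_successor lsucc.
have LSlp : [set: LS K] #< [set: lam_plus] by exact: card_lt_le_trans LSlam (proj1 ll).
split=> [[_ Mpres Mmin]|Mlam].
  have [a Ma] := dc_exists M.
  have Msmall := presentable_small lpunc lpreg LSlp Mpres.
  have al := card_gt_succ lsucc (small_dc_lt Msmall Ma).
  (* Otherwise M is already presentable at the successor of max(dc M, LS). *)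
  have la : [set: lam] #<= [set: a].
    apply: contrapT => /card_ltNge alt.
    have [b [ab LSb blam]] : exists b : small,
        [/\ [set: a] #<= [set: b], [set: LS K] #<= [set: b] & [set: b] #< [set: lam]].
      by have [LSa|aLS] := card_le_total [set: LS K] [set: a]; [exists a|exists (LS K)].
    have [k bk klam] := successor_below blam; have binf : infinite b.
      exact: card_le_trans (LS_infinite K) LSb.
    have kunc := uncountable_gt binf (proj1 bk).
    have Mk : small_dc k (sval M).
      by apply: dc_is_small Ma _; exact: card_le_lt_trans ab (proj1 bk).
    apply: (proj2 ll); apply: card_le_trans klam; apply: Mmin.
      exact: regular_successor bk.
    exact: small_presentable.
  have [d dM ad] := Ma; exists d => //.
  by apply: card_eq_trans ad; apply/card_eqPle.
split=> // [|m mreg Mm].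
  by apply: small_presentable => //; exact: dc_is_small Mlam ll.
(* A regular [m] at most [lam] with [M] presentable at [m] is raised to [l], the larger of [m] and
   the successor of [LS K]. This [l] is still at most [lam], and presentability at [l] forces the
   density character below [l]. *)
apply: contrapT => /card_ltNge/(card_gt_succ lsucc) mlam.
have [k LSk klam] := successor_below LSlam.
have kunc := uncountable_gt (LS_infinite K) (proj1 LSk).
have [l [lreg ml kl llam]] : exists l : small, [/\ regular l, [set: m] #<= [set: l],
    [set: k] #<= [set: l] & [set: l] #<= [set: lam]].
  have [km|mk] := card_le_total [set: k] [set: m]; first by exists m.
  by exists k; split=> //; apply: regular_successor LSk; exact: LS_infinite.
have LSl := card_lt_le_trans (proj1 LSk) kl.
have l_unc : uncountable l by exact: uncountable_gt (LS_infinite K) LSl.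
have := small_dc_lt (presentable_small l_unc lreg LSl (presentable_le ml Mm)) Mlam.
by move=> [_ /(_ llam)].
Qed.

End Accessible.

(* Without LS < lam the last equivalence is false: take for K the isomorphic
   copies of one rigid discrete structure of cardinality LS = lam. *)
Theorem theorem3p1 (R : realType) (L : language) (K : mAEC R L) :
  [/\ has_card_directed_colimits nat (mAEC_category K),
      (forall lam : small, uncountable lam -> regular lam ->
         [set: LS K] #< [set: lam] ->
         accessible lam (mAEC_category K)) &
      (forall lam lam_plus : small, uncountable lam ->
         [set: LS K] #< [set: lam] -> is_successor lam lam_plus ->
         forall M : mAEC_category K,
           presentability_rank M lam_plus <-> dc_is (sval M) lam)].
Proof.
split=> [I le dir D|lam|lam lam_plus lunc LSlam lsucc M].
- by have [X [c [ccol _]]] := dense_colimit_exists D dir; exists X, c.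
- exact: accessible_mAEC.
- exact: presentability_rank_dc.
Qed.
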